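(* Let $(V^*,\mathcal P^* )$ be an $\mathbb L$-valued random variable with $0<\mathbb E(|\mathcal P^*|)\le1$, and let $\mathbb P$ be the probability on $\Omega=\mathbb L^{\mathbb Z}$ under which $(\omega_n,n\in\mathbb Z)$ is i.i.d. with common distribution that of $(V^*,\mathcal P^* )$. Let $G=\inf\{k\ge0:T(k)=\infty\}$. Then under $\mathbb P$ the sequence $$\Big(\big(T(k)-T(k-1),\mathcal Q(k)\big),\ k=1,\ldots,G-1\Big)$$ is equal in distribution to $\big((T^*(k),\mathcal Q^*(k)),k=1,\ldots,G^*-1\big)$, where the random variables $((T^*(k),\mathcal Q^*(k)),k\ge1)$ are i.i.d. with common distribution that of $(T^*,\mathcal Q^* )$ satisfying $$\mathbb E\left[f(\mathcal Q^* )g(T^* )\right]=\frac1{\mathbb E(|\mathcal P^*|)}\sum_{t\ge1}\sum_{x\ge0}\mathbb E\left[f\circ\Upsilon_x(\mathcal P^* );\ |\mathcal P^*|\ge x+1\right]\,g(t)\,\mathbb P\left(\tau^-_x=t-1\right)$$ for all bounded measurable functions $f:\mathcal M\to\mathbb R_+$ and $g:\mathbb Z_+\to\mathbb R_+$, and $G^*$ is an independent geometric random variable with parameter $1-\mathbb E(|\mathcal P^*|)$.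
   Context: $\mathcal M$ is the set of finite point measures on $(0,\infty)$, endowed with the weak topology. For $\nu\in\mathcal M$, $|\nu|=\nu(0,\infty)$ and $\pi(\nu)$ is the supremum of its support ($0$ for the zero measure $\mathbf z$). $\Upsilon_k(\nu)$ is obtained from $\nu$ by removing its $k$ largest atoms, counted with multiplicity ($\Upsilon_k(\nu)=\mathbf z$ if $k\ge|\nu|$). $\mathbb L=\{(v,\nu)\in(0,\infty)\times\mathcal M:v\ge\pi(\nu)\}$, $\Omega=\mathbb L^{\mathbb Z}$ with the product $\sigma$-algebra, $\omega=(\omega_n,n\in\mathbb Z)\in\Omega$ with $\omega_n=(V_n,\mathcal P_n)$. All quantities below are functions of $\omega$; $\theta_n(\omega)=(\omega_{n+k},k\in\mathbb Z)$ is the shift, and in $X\circ\theta_n$ everything in $X$ is evaluated at $\theta_n(\omega)$. Lukasiewicz path: $S(0)=0$ and, for $n\ge1$, $S(n)=\sum_{k=0}^{n-1}(|\mathcal P_k|-1)$. Weak ascending ladder times: $T(0)=0$, $T(k+1)=\inf\{\ell>T(k):S(\ell)\ge S(T(k))\}$, with $\inf\emptyset=\infty$ (and $T(k+1)=\infty$ if $T(k)=\infty$). For $\ell\ge0$: $\tau_\ell=\inf\{k>0:S(k)\ge\ell\}$ and $\tau^-_\ell=\inf\{k\ge0:S(k)=-\ell\}$. If $\tau_\ell<\infty$, $\zeta_\ell=\ell-S(\tau_\ell-1)$ and $\mu_\ell=\Upsilon_{\zeta_\ell}(\mathcal P_{\tau_\ell-1})$. For $k\ge1$ with $T(k)<\infty$,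 $\mathcal Q(k)=\mu_0\circ\theta_{T(k-1)}$. A geometric random variable $G^*$ with parameter $q$ satisfies $\mathbb P(G^*=k)=q(1-q)^{k-1}$, $k\ge1$ (and $G^*=\infty$ a.s. if $q=0$). $\mathbb E[X;A]$ means $\mathbb E[X\mathbf 1_A]$. *)

(* Defs.v *)
From HB Require Import structures.
From mathcomp Require Import all_boot all_order all_algebra.
From mathcomp Require Import all_classical all_reals all_analysis.
From mathcomp Require Import measurable_realfun lra.

Set Implicit Arguments.
Unset Strict Implicit.
Unset Printing Implicit Defensive.

Import Order.TTheory GRing.Theory Num.Theory.
Import numFieldNormedType.Exports.

Local Open Scope classical_set_scope.
Local Open Scope ring_scope.

(** A finite point measure on (0, oo) is a finite sum of Dirac masses, i.e. a
    finite multiset of points of (0, oo).  It is represented by the list of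
    its atoms, repeated according to multiplicity, in nonincreasing order, so
    that Leibniz equality is equality of measures (see [ptmeas_measure_inj]). *)
Record ptmeas (R : realType) := PtMeas {
  atoms : seq R;
  atomsP : all (fun x => 0 < x) atoms && sorted >=%R atoms }.

HB.instance Definition _ (R : realType) := [isSub for @atoms R].
HB.instance Definition _ (R : realType) := [Choice of ptmeas R by <:].

Definition ptmeas0 (R : realType) : ptmeas R := @PtMeas R [::] isT.

HB.instance Definition _ (R : realType) :=
  isPointed.Build (ptmeas R) (ptmeas0 R).

Section ptmeas_theory.
Context {R : realType}.
Implicit Types nu : ptmeas R.

Definition ptmeas_measure nu : {measure set R -> \bar R} :=
  msum (fun i => \d_(nth 0 (atoms nu) i) : {measure set R -> \bar R})
       (size (atoms nu)).

Lemma ptmeas_measureE nu (A : set R) :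
  ptmeas_measure nu A = (count (mem A) (atoms nu))%:R%:E.
Proof.
rewrite /ptmeas_measure /= /msum; elim: (atoms nu) => [|x s IH] /=.
  by rewrite big_ord0.
by rewrite big_ord_recl /= IH diracE -EFinD -natrD.
Qed.

Definition mass nu : nat := size (atoms nu).

Lemma mass_measure nu : ptmeas_measure nu (`]0, +oo[)%classic = (mass nu)%:R%:E.
Proof.
rewrite ptmeas_measureE; congr (_%:R%:E).
apply/eqP; rewrite /mass -all_count; apply/allP => x xnu /=.
have /andP[/allP pos _] := atomsP nu.
by rewrite mem_setE in_itv/= andbT; exact: pos.
Qed.

Lemma ptmeas_measure_inj nu nu' :
  (forall A, measurable A -> ptmeas_measure nu A = ptmeas_measure nu' A) ->
  nu = nu'.
Proof.
move=> h; apply: val_inj => /=.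
have /andP[_ s1] := atomsP nu; have /andP[_ s2] := atomsP nu'.
apply: (sorted_eq _ _ s1 s2).
- by move=> y x z /= yx zy; exact: le_trans zy yx.
- by move=> x y /= /le_anti.
apply/allP => x _ /=; move: (h [set x] (measurable_set1 x)).
rewrite !ptmeas_measureE => -[] /eqP; rewrite eqr_nat.
have E : mem [set x] =1 pred1 x.
  by move=> y; apply/idP/eqP; [move/set_mem|move=> ->; exact: mem_set].
by rewrite !(eq_count E).
Qed.

(** Supremum of the support; [sup set0 = 0] gives the value at the zero
    measure. *)
Definition pi_sup nu : R := sup [set x | x \in atoms nu].

Lemma upsilon_subproof (k : nat) nu :
  all (fun x => 0 < x) (drop k (atoms nu)) && sorted >=%R (drop k (atoms nu)).
Proof.
have /andP[pos srt] := atomsP nu; apply/andP; split.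
  by apply/allP => x /mem_drop xnu; exact: (allP pos).
by apply: drop_sorted.
Qed.

Definition upsilon (k : nat) nu : ptmeas R := PtMeas (upsilon_subproof k nu).

End ptmeas_theory.

(** Weak topology: the coarsest topology making [nu |-> \int f dnu] continuous
    for all bounded continuous [f : (0, oo) -> R].  The values of [f] outside
    (0, oo) are irrelevant. *)
Definition weak_test (R : realType) := {f : R -> R |
  {within (`]0, +oo[%classic : set R), continuous f} /\
  exists C : R, forall x, 0 < x -> `|f x| <= C}.

Definition weak_eval {R : realType} (f : weak_test R) (nu : ptmeas R) : R :=
  \int[ptmeas_measure nu]_(x in `]0, +oo[) (sval f x).

Lemma weak_evalE (R : realType) (f : weak_test R) (nu : ptmeas R) :
  weak_eval f nu = \sum_(x <- atoms nu) sval f x.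
Proof.
case: f => f [cf bf]; rewrite /weak_eval /Rintegral /=.
have mD : measurable (`]0, +oo[%classic : set R) by exact: measurable_itv.
have mf : measurable_fun (`]0, +oo[%classic : set R) (fun x : R => (f x)%:E : \bar R).
  by apply/measurable_EFinP; exact: subspace_continuous_measurable_fun.
have part (h : R -> \bar R) :
    measurable_fun (`]0, +oo[%classic : set R) h -> (forall x, 0 <= h x)%E ->
    (\int[ptmeas_measure nu]_(x in (`]0%R, +oo[%classic : set R)) h x)%E = (\sum_(x <- atoms nu) h x)%E.
  move=> mh h0; rewrite ge0_integral_measure_sum// (big_nth 0) big_mkord.
  apply: eq_bigr => i _; rewrite integral_dirac// diracE mem_set ?mul1e//=.
  have /andP[/allP pos _] := atomsP nu.
  by rewrite in_itv/= andbT; apply: pos; exact: mem_nth.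
rewrite integralE part; [|exact: measurable_funepos|by []].
rewrite part; [|exact: measurable_funeneg|by []].
have sE (h : R -> \bar R) (k : R -> R) : (forall x, h x = (k x)%:E) ->
    (\sum_(x <- atoms nu) h x = (\sum_(x <- atoms nu) k x)%:E)%E.
  by move=> hk; rewrite -sumEFin; apply: eq_bigr.
rewrite (sE _ (fun x => Num.max (f x) 0)); last by move=> x; rewrite funeposE -EFin_max.
rewrite (sE _ (fun x => Num.max (- f x) 0)); last by move=> x; rewrite funenegE -EFin_max.
rewrite -EFinB/= -sumrB; apply: eq_bigr => x _.
by case: (lerP (f x) 0); case: (lerP (- f x) 0) => *; lra.
Qed.

Definition ptmeas_weak (R : realType) :=
  sup_topology (fun f : weak_test R =>
    Topological.class (initial_topology (weak_eval f))).

HB.instance Definition _ (R : realType) :=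
  Topological.copy (ptmeas R) (ptmeas_weak R).

HB.instance Definition _ (R : realType) :=
  Measurable.copy (ptmeas R) (g_sigma_algebraType (@open (ptmeas R))).

Record state (R : realType) := LPair {
  Lval : R * ptmeas R;
  LvalP : (0 < Lval.1) && (pi_sup Lval.2 <= Lval.1) }.

HB.instance Definition _ (R : realType) := [isSub for @Lval R].
HB.instance Definition _ (R : realType) := [Choice of state R by <:].

Lemma L_point_subproof (R : realType) :
  (0 < (1 : R, ptmeas0 R).1) &&
  (pi_sup (1 : R, ptmeas0 R).2 <= (1 : R, ptmeas0 R).1).
Proof.
rewrite /= ltr01 /= /pi_sup /= (_ : [set x | _] = set0) ?sup0 ?ler01//.
by apply/seteqP; split.
Qed.

HB.instance Definition _ (R : realType) :=
  isPointed.Build (state R) (LPair (L_point_subproof R)).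

HB.instance Definition _ (R : realType) :=
  Measurable.copy (state R) (g_sigma_algebra_preimageType (@Lval R)).

Definition Vof {R : realType} (x : state R) : R := (Lval x).1.
Definition Pof {R : realType} (x : state R) : ptmeas R := (Lval x).2.

Definition power (I T : Type) : Type := I -> T.

HB.instance Definition _ (I : Type) (T : pointedType) :=
  Pointed.copy (power I T) (I -> T).

Definition cylinders (I : Type) d (T : measurableType d) : set (set (power I T)) :=
  \bigcup_(i in [set: I])
    preimage_set_system setT (fun x : power I T => x i) measurable.

HB.instance Definition _ (I : Type) d (T : measurableType d) :=
  Measurable.copy (power I T) (g_sigma_algebraType (@cylinders I d T)).

Definition option_display : measure_display -> measure_display.
Proof. exact. Qed.

(** [option T] is [T] with an isolated extra point [None] adjoined. *)
Section option_measurable.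
Context d (T : measurableType d).

Definition option_measurable : set (set (option T)) :=
  [set A | measurable (Some @^-1` A)].

Let option_measurable0 : option_measurable set0.
Proof. by rewrite /option_measurable /= preimage_set0. Qed.

Let option_measurableC A : option_measurable A -> option_measurable (~` A).
Proof. by rewrite /option_measurable /= preimage_setC; exact: measurableC. Qed.

Let option_measurable_bigcup (F : (set (option T))^nat) :
  (forall i, option_measurable (F i)) -> option_measurable (\bigcup_i F i).
Proof.
rewrite /option_measurable /= preimage_bigcup => mF.
exact: bigcupT_measurable.
Qed.

HB.instance Definition _ := isPointed.Build (option T) None.

HB.instance Definition _ := @isMeasurable.Build (option_display d) (option T)
  option_measurable option_measurable0 option_measurableC
  option_measurable_bigcup.

End option_measurable.

Section probability_notions.
Context {R : realType}.

Definition independent_family d (W : measurableType d) (P : probability W R)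
    d' (E : measurableType d') (I : eqType) (X : I -> W -> E) : Prop :=
  forall (s : seq I) (B : I -> set E), uniq s ->
    (forall i, measurable (B i)) ->
    P (\big[setI/setT]_(i <- s) (X i @^-1` B i)) =
      (\prod_(i <- s) P (X i @^-1` B i))%E.

Definition independent_pair d (W : measurableType d) (P : probability W R)
    d1 (E1 : measurableType d1) d2 (E2 : measurableType d2)
    (X : W -> E1) (Y : W -> E2) : Prop :=
  forall A B, measurable A -> measurable B ->
    P (X @^-1` A `&` Y @^-1` B) = (P (X @^-1` A) * P (Y @^-1` B))%E.

Definition eq_in_law d1 (W1 : measurableType d1) (P1 : probability W1 R)
    d2 (W2 : measurableType d2) (P2 : probability W2 R)
    d' (E : measurableType d') (X1 : W1 -> E) (X2 : W2 -> E) : Prop :=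
  [/\ measurable_fun setT X1, measurable_fun setT X2 &
      forall B, measurable B -> P1 (X1 @^-1` B) = P2 (X2 @^-1` B)].

(** [None] stands for infinity. *)
Definition geometric_law d (W : measurableType d) (P : probability W R)
    (G : W -> option nat) (q : R) : Prop :=
  (forall k, (1 <= k)%N ->
     P [set w | G w = Some k] = (q * (1 - q) ^+ k.-1)%:E) /\
  (q = 0 -> P [set w | G w = None] = 1%E).

End probability_notions.

(** [None] stands for infinity, i.e. [inf] of the empty set. *)
Definition inf_nat (p : pred nat) : option nat :=
  if pselect (exists n, p n) is left h then Some (ex_minn h) else None.

Definition ltn_inf (k : nat) (n : option nat) : bool :=
  if n is Some m then (k < m)%N else true.

(** The sequence [X 0, X 1, ...] is the mathematical sequence
    [x_1, x_2, ...]; [killed G X] is the finite or infinite sequence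
    [(x_k, k = 1, ..., G - 1)], padded with [None]. *)
Definition killed (E : Type) (G : option nat) (X : nat -> E) :
    power nat (option E) :=
  fun i => if ltn_inf i.+1 G then Some (X i) else None.

Definition Omega (R : realType) : Type := power int (state R).

HB.instance Definition _ (R : realType) :=
  Measurable.copy (Omega R) (power int (state R)).

Section functionals.
Context {R : realType}.
Implicit Types om : Omega R.

Definition theta (n : int) om : Omega R := fun k => om (n + k).

(** Lukasiewicz path. *)
Definition Sluk om (n : nat) : int :=
  \sum_(0 <= k < n) ((mass (Pof (om k%:Z)))%:Z - 1).

(** Weak ascending ladder times. *)
Fixpoint Tlad om (k : nat) : option nat :=
  if k is k'.+1 then
    if Tlad om k' is Some m then
      inf_nat (fun l => (m < l)%N && (Sluk om m <= Sluk om l))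
    else None
  else Some 0%N.

Definition Gstop om : option nat := inf_nat (fun k => Tlad om k == None).

Definition tau om (l : nat) : option nat :=
  inf_nat (fun k => (0 < k)%N && (l%:Z <= Sluk om k)).

Definition tau_minus om (l : nat) : option nat :=
  inf_nat (fun k => Sluk om k == - l%:Z).

(** [zeta] and [mu] are only meaningful when [tau om l] is finite; then
    [zeta] is nonnegative, so that the absolute value in [mu] is harmless. *)
Definition zeta om (l : nat) : int :=
  if tau om l is Some t then l%:Z - Sluk om t.-1 else 0.

Lemma zeta_ge0 om l : 0 <= zeta om l.
Proof.
rewrite /zeta /tau /inf_nat; case: pselect => //= h.
case: ex_minnP => -[|[|t]] // _ tmin; rewrite subr_ge0.
  by rewrite /Sluk /= big_geq.
by rewrite leNgt; apply/negP => /ltW lS; have := tmin t.+1; rewrite /= lS ltnn => /(_ isT).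
Qed.

Definition mu om (l : nat) : ptmeas R :=
  if tau om l is Some t then upsilon `|zeta om l|%N (Pof (om t.-1%:Z))
  else ptmeas0 R.

(** Only meaningful when [k >= 1] and [Tlad om k] is finite. *)
Definition Q om (k : nat) : ptmeas R :=
  if Tlad om k.-1 is Some t then mu (theta t%:Z om) 0 else ptmeas0 R.

(** Entry [i] is the pair [(T(k) - T(k-1), Q(k))] with [k = i + 1]. *)
Definition excursions om (i : nat) : nat * ptmeas R :=
  ((odflt 0 (Tlad om i.+1) - odflt 0 (Tlad om i))%N, Q om i.+1).

End functionals.

Section excursion_law.
Context {R : realType}.

Definition mean_mass d0 (W0 : measurableType d0) (P0 : probability W0 R)
    (VP : W0 -> state R) : \bar R :=
  'E_P0[fun w => (mass (Pof (VP w)))%:R].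

Definition bounded_measurable_nonneg d (E : measurableType d) (f : E -> R) :=
  [/\ measurable_fun setT f, (forall x, 0 <= f x) &
      exists C : R, forall x, f x <= C].

(** [kappa] is the law of the pair (duration, measure), while the formula
    lists the measure first. *)
Definition is_excursion_law d0 (W0 : measurableType d0)
    (P0 : probability W0 R) (VP : W0 -> state R) (P : probability (Omega R) R)
    (kappa : probability (nat * ptmeas R)%type R) : Prop :=
  forall (f : ptmeas R -> R) (g : nat -> R),
    bounded_measurable_nonneg f -> bounded_measurable_nonneg g ->
    ('E_kappa[fun z => (f z.2 * g z.1)%R] =
     ((fine (mean_mass P0 VP))^-1)%:E *
     \sum_(1 <= t <oo) \sum_(0 <= x <oo)
       ('E_P0[fun w => (f (upsilon x (Pof (VP w))) *
                 \1_[set w | (x.+1 <= mass (Pof (VP w)))%N] w)%R]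
        * (g t)%:E * P [set om | tau_minus om x = Some t.-1]))%E.

End excursion_law.

(* Main.v *)
Require Import Defs.
From HB Require Import structures.
From mathcomp Require Import all_boot all_order all_algebra.
From mathcomp Require Import all_classical all_reals all_analysis.
From mathcomp Require Import measurable_realfun lra zify.

Set Implicit Arguments.
Unset Strict Implicit.
Unset Printing Implicit Defensive.

Import Order.TTheory GRing.Theory Num.Theory.
Import numFieldNormedType.Exports.

Local Open Scope classical_set_scope.
Local Open Scope ring_scope.

(** The increments [mass - 1] of the path are at least [-1], so the path can
    only descend one level at a time; everything rests on this.

    Cut the path at [T(1) = t].  Then [T(1) = t] and [S(t-1) = -x] hold exactly
    when the path stays negative at times [1, ..., t-1], ends this stretch at
    [-x], and [P_(t-1)] has at least [x + 1] atoms; in that case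
    [Q(1) = upsilon x P_(t-1)] ([Tlad1P], [Q1E]).  The stretch before [t-1] only
    involves the masses of [P_0, ..., P_(t-2)], so it is a finite word of
    natural numbers, and the event is a countable disjoint union of rectangles
    indexed by words ([rect_excursion]).  Read backwards, a word along which
    the path stays negative and ends at [-x] becomes a word whose path visits
    [-x] for the first time at its end, and both have the same weight.  Summing
    over words turns the mass of the stretch into [P (tau_minus x = t-1)]
    ([time_reversal]), and the law of [(T(1), Q(1))] on [T(1) < oo] into the
    double series of the excursion law, without its factor [1 / E |P*|]
    ([first_excursion_law_passage]).

    After [T(1)] the path starts afresh.  In terms of rectangles: an event on
    the first [n + 1] excursions is a disjoint union, over the word of the
    first excursion, of a rectangle followed by an event on the next [n]
    excursions, and induction on [n] gives the product formula
    ([P_excursions]).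

    It remains that [P (T(1) < oo) = E |P*|], i.e. that
    [sum_j P(|P*| > j) h_j = E |P*|], where [h_x] is the probability of ever
    visiting [-x].  Conditioning on the first step, [h_(x+1) = sum_n p_n h_(x+n)],
    whence the differences [d_x = h_x - h_(x+1)] satisfy
    [d_x = sum_j P(|P*| > j) d_(x+j)].  Summing over [x], with [l = lim h],
    gives [1 - l = sum_j P(|P*| > j) (h_j - l) <= E |P*| (1 - l)].  As
    [E |P*| <= 1], either [l = 1] or [E |P*| = 1], and the sum to compute, which
    is [1 - l + l E |P*|], equals [E |P*|] in both cases ([tail_hit_prob]).

    So the number of completed excursions has geometric tails, excursions are
    independent of each other, and the events prescribing finitely many initial
    entries determine the law of a sequence that stays undefined once it has
    become undefined ([eq_in_law_absorbed]).

    Measurability comes from topology: the ordered atoms of a point measure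
    depend continuously on it, so [upsilon k] is continuous
    ([upsilon_continuous]). *)

(** * Continuity of the atoms for the weak topology *)

Section weak_topology.
Context {R : realType}.
Implicit Types nu : ptmeas R.

Lemma weak_eval_continuous (f : weak_test R) : continuous (@weak_eval R f).
Proof.
move=> nu; have /cvg_sup/(_ f) h : nbhs nu --> nu by exact: cvg_id.
by apply: cvg_trans (@initial_continuous _ _ (weak_eval f) nu); exact: cvg_app.
Qed.

Lemma cvg_weak (T : Type) (F : set_system T) (FF : Filter F)
    (X : T -> ptmeas R) nu :
  (forall f, weak_eval f (X t) @[t --> F] --> weak_eval f nu) ->
  X t @[t --> F] --> nu.
Proof.
move=> h; apply/cvg_sup => f U [/= _ [[V /= oV <-]] /= Vnu] /filterS; apply.
by apply: h; exact: open_nbhs_nbhs.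
Qed.

(** Compares the ordered atoms with a level through the number of atoms above
    that level, which integrals of test functions can estimate. *)
Lemma count_nonincreasing (q : pred R) (s : seq R) (i : nat) :
    (forall x y, x <= y -> q x -> q y) -> sorted >=%R s ->
  (i < count q s)%N = (i < size s)%N && q (nth 0 s i).
Proof.
move=> qup; elim: s i => [|x s IH] i //= xs; have {}IH := IH ^~ (path_sorted xs).
case: (boolP (q x)) => qx; first by case: i => [|i] //=; rewrite add1n ltnS IH.
have /allP hall : all (predC q) s.
  have tr : transitive (>=%R : rel R) by move=> a b c /= ab /le_trans; apply.
  have := xs; rewrite path_sortedE// => /andP[/allP xs' _].
  by apply/allP => y /xs' /= yx; apply: contra qx; exact: qup.
have -> : count q s = 0%N.
  by apply/eqP; rewrite -leqn0 leqNgt -has_count; apply/hasPn.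
case: i => [|i] /=; first by rewrite (negbTE qx).
rewrite ltn0; apply/esym/negP => /andP[si]; apply/negP/hall.
exact: mem_nth.
Qed.

Definition ramp (a b x : R) : R := Num.min 1 (Num.max 0 ((x - a) / (b - a))).

Lemma ramp_continuous a b : continuous (ramp a b).
Proof.
pose slope (x : R) : R^o := (x - a) / (b - a).
move=> x; apply: (@continuous_min R R (cst (1 : R^o))
  (fun x => Num.max 0 (slope x) : R^o)); first exact: cvg_cst.
apply: (@continuous_max R R (cst (0 : R^o)) slope); first exact: cvg_cst.
by apply: cvgMl; apply: cvgB; [exact: cvg_id|exact: cvg_cst].
Qed.

Lemma ramp_bounds a b x : a < b ->
  ((b <= x)%R%:R <= ramp a b x :> R) /\ (ramp a b x <= (a < x)%R%:R :> R).
Proof.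
move=> ab; rewrite /ramp; have ba : 0 < b - a by lra.
split.
  case: (leP b x) => bx /=; last by rewrite le_min ler01 le_max lexx.
  by rewrite le_min lexx le_max ler_pdivlMr// mul1r; apply/orP; right; lra.
case: (ltP a x) => ax /=; first by rewrite ge_min lexx.
rewrite ge_min ge_max lexx /= ler_pdivrMr// mul0r.
by apply/orP; right; lra.
Qed.

Lemma weak_test_ramp_subproof a b :
  {within (`]0, +oo[%classic : set R), continuous (ramp a b)} /\
  exists C : R, forall x, 0 < x -> `|ramp a b x| <= C.
Proof.
split; first by apply: continuous_subspaceT => x; exact: ramp_continuous.
exists 1 => x _; have h0 : 0 <= ramp a b x by rewrite le_min ler01 le_max lexx.
by rewrite ger0_norm// ge_min lexx.
Qed.

Definition weak_ramp a b : weak_test R :=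
  exist _ (ramp a b) (weak_test_ramp_subproof a b).

(** A ramp lies between the indicators of two half-lines, so counts of atoms are
    bounded on both sides by a continuous functional. *)
Lemma weak_ramp_bounds a b nu : a < b ->
  ((count (>= b) (atoms nu))%:R <= weak_eval (weak_ramp a b) nu) /\
  (weak_eval (weak_ramp a b) nu <= (count (> a) (atoms nu))%:R).
Proof.
move=> ab; rewrite weak_evalE /=.
rewrite -!sum1_count !natr_sum; split; rewrite big_mkcond.
  apply: ler_sum => x _; have [h1 _] := ramp_bounds x ab.
  by case: (b <= x) h1.
rewrite [leRHS]big_mkcond; apply: ler_sum => x _.
by have [_ h2] := ramp_bounds x ab; case: (a < x) h2.
Qed.

Lemma atoms_sorted nu : sorted >=%R (atoms nu).
Proof. by have /andP[] := atomsP nu. Qed.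

Lemma atoms_gt0 nu i : (i < mass nu)%N -> 0 < nth 0 (atoms nu) i.
Proof. by have /andP[/allP h _] := atomsP nu; move=> /(mem_nth 0)/h. Qed.

Lemma atom_ge0 nu i : 0 <= nth 0 (atoms nu) i.
Proof.
have [/atoms_gt0/ltW//|h] := ltnP i (mass nu).
by rewrite nth_default.
Qed.

(** The [i]-th atom exceeds [c] as soon as the integral of a ramp supported above
    [c] exceeds [i], and it is below [c] as soon as the integral of a ramp equal
    to 1 above [c] is less than [i + 1]: both are open conditions. The default
    value 0 of [nth] makes the statement hold for all [i]. *)
Lemma atom_continuous i : continuous (fun nu => nth 0 (atoms nu) i : R).
Proof.
move=> nu; set x : R := nth 0 (atoms nu) i.
have above (c : R) : c < x -> \forall nu' \near nu, c < nth 0 (atoms nu') i.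
  move=> cx; have [c0|c0] := ltP c 0.
    by apply: (@nearW _ (nbhs nu)) => nu'; apply: lt_le_trans c0 _; exact: atom_ge0.
  have im : (i < size (atoms nu))%N.
    rewrite ltnNge; apply/negP => h; move: cx.
    by rewrite /x nth_default// ltNge c0.
  have [h1 _] := weak_ramp_bounds nu cx.
  have := @weak_eval_continuous (weak_ramp c x) nu.
  move/cvgr_gt => /(_ i%:R) h.
  have {h} : \forall nu' \near nu, i%:R < weak_eval (weak_ramp c x) nu'.
    apply: h; apply: lt_le_trans h1; rewrite ltr_nat.
    rewrite count_nonincreasing ?im ?lexx//; last exact: atoms_sorted.
    by move=> y z /= yz xy; exact: le_trans yz.
  apply: (@filterS _ (nbhs nu)) => nu'; have [_ h2] := weak_ramp_bounds nu' cx.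
  move=> /lt_le_trans/(_ h2); rewrite ltr_nat.
  rewrite count_nonincreasing; [by move=> /andP[]| |exact: atoms_sorted].
  by move=> y z /= yz cy; exact: lt_le_trans yz.
have below (c : R) : x < c -> \forall nu' \near nu, nth 0 (atoms nu') i < c.
  move=> xc; have c0 : 0 < c by apply: le_lt_trans xc; exact: atom_ge0.
  have [_ h1] := weak_ramp_bounds nu xc.
  have := @weak_eval_continuous (weak_ramp x c) nu.
  move/cvgr_lt => /(_ i.+1%:R) h.
  have {h} : \forall nu' \near nu, weak_eval (weak_ramp x c) nu' < i.+1%:R.
    apply: h; apply: le_lt_trans h1 _; rewrite ltr_nat.
    rewrite ltnNge count_nonincreasing ?ltxx ?andbF//; last exact: atoms_sorted.
    by move=> y z /= yz xy; exact: lt_le_trans yz.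
  apply: (@filterS _ (nbhs nu)) => nu'; have [h2 _] := weak_ramp_bounds nu' xc.
  move=> /(le_lt_trans h2); rewrite ltr_nat ltnS leqNgt count_nonincreasing.
  - rewrite negb_and -leqNgt -ltNge => /orP[h3|//].
    by rewrite nth_default.
  - by move=> y z /= yz cy; exact: le_trans yz.
  - exact: atoms_sorted.
have FF : Filter (nbhs nu) := nbhs_filter nu.
apply/(@cvgrPdist_lt _ _ _ (nbhs nu)) => e e0.
have := above (x - e) ltac:(lra); have := below (x + e) ltac:(lra).
apply: (@filterS2 _ (nbhs nu)) => nu' h2 h1.
by rewrite ltr_distlC h1 h2.
Qed.

Definition weak_one : weak_test R.
Proof.
exists (cst 1); split; last by exists 1 => x _; rewrite normr1.
by apply: continuous_subspaceT => x; exact: cst_continuous.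
Defined.

Lemma weak_oneE nu : weak_eval weak_one nu = (mass nu)%:R.
Proof. by rewrite weak_evalE /= /cst big_const_seq count_predT iter_addr_0. Qed.

(** The mass is the integral of the constant 1 and takes integer values. *)
Lemma mass_locally_constant nu : \forall nu' \near nu, mass nu' = mass nu.
Proof.
have := @weak_eval_continuous weak_one nu.
move=> /cvgrPdist_lt/(_ 1 ltr01); apply: filterS => nu' /=.
rewrite !weak_oneE ltr_distlC => /andP[h1 h2].
have {}h1 : (mass nu < (mass nu').+1)%N.
  by rewrite -(ltr_nat R) -natr1 -ltrBlDr.
have {}h2 : (mass nu' < (mass nu).+1)%N by rewrite -(ltr_nat R) -natr1.
by apply/eqP; rewrite eqn_leq -ltnS h2 -ltnS h1.
Qed.

Lemma weak_eval_upsilon k (f : weak_test R) nu :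
  weak_eval f (upsilon k nu) =
  \sum_(k <= i < mass nu) sval f (nth 0 (atoms nu) i).
Proof.
rewrite weak_evalE /= (big_nth 0) size_drop -[k in RHS]add0n big_addn.
by apply: eq_bigr => i _; rewrite nth_drop addnC.
Qed.

(** Near [nu] the mass is constant, so integrating [f] against [upsilon k] is a
    fixed finite sum of values of [f] at continuously moving positive points. *)
Lemma upsilon_continuous k : continuous (@upsilon R k).
Proof.
move=> nu; have FF : Filter (nbhs nu) := nbhs_filter nu.
apply: cvg_weak => f.
apply: (@cvg_trans _
  (\sum_(k <= i < mass nu) sval f (nth 0 (atoms nu') i) @[nu' --> nu])).
  apply: (@near_eq_cvg _ _ (nbhs nu)); have := mass_locally_constant nu.
  by apply: filterS => nu' h; rewrite weak_eval_upsilon h.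
rewrite weak_eval_upsilon.
have cvg_sum (r : seq nat) : all (fun i => i < mass nu)%N r ->
    \sum_(i <- r) sval f (nth 0 (atoms nu') i) @[nu' --> nu] -->
    \sum_(i <- r) sval f (nth 0 (atoms nu) i).
  elim: r => [_|i r IH /= /andP[im rm]].
    rewrite big_nil (_ : (fun _ => _) = cst 0); first exact: cvg_cst.
    by apply/funext => nu'; rewrite big_nil.
  rewrite big_cons (_ : (fun _ => _) = (fun nu' : ptmeas R =>
    sval f (nth 0 (atoms nu') i) + \sum_(j <- r) sval f (nth 0 (atoms nu') j))).
    apply: (@cvgD _ R^o _ (nbhs nu)); last exact: IH.
apply: (@continuous_cvg _ R R (nbhs nu) FF
      (fun x : ptmeas R => nth 0 (atoms x) i) (sval f)).
      have [+ _] := svalP f; rewrite continuous_open_subspace.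
        by apply; rewrite inE/= in_itv/= andbT; exact: atoms_gt0.
      exact: interval_open.
    exact: atom_continuous.
  by apply/funext => nu'; rewrite big_cons.
apply: cvg_sum; apply/allP => i; rewrite mem_index_iota => /andP[]//.
Qed.

Lemma measurable_upsilon k : measurable_fun setT (@upsilon R k).
Proof.
apply: (@measurability _ _ (ptmeas R) (ptmeas R) setT _ (@open (ptmeas R)) erefl)
  => _ [B oB <-].
rewrite setTI; apply: sub_sigma_algebra.
by move/continuousP: (@upsilon_continuous k); apply.
Qed.

Lemma measurable_mass : measurable_fun setT (@mass R).
Proof.
move=> _ B _; rewrite setTI; apply: sub_sigma_algebra.
have : open (@mass R @^-1` B); last by [].
rewrite openE => nu Bnu.
apply: (@filterS _ (nbhs nu)) (mass_locally_constant nu) => nu' /= massE.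
by rewrite /preimage /= massE.
Qed.

End weak_topology.

(** * Words of masses and the Lukasiewicz path *)

Section infimum.
Implicit Types p q : pred nat.

Lemma inf_nat_Some p t :
  inf_nat p = Some t <-> p t /\ forall j, (j < t)%N -> ~~ p j.
Proof.
rewrite /inf_nat; case: pselect => [h|h]; last first.
  by split=> // -[pt _]; case: h; exists t.
case: ex_minnP => m pm mmin; split=> [[<-]|[pt tmin]].
  by split=> // j jm; apply/negP => /mmin; rewrite leqNgt jm.
congr Some; apply/eqP; rewrite eqn_leq mmin//= leqNgt.
by apply/negP => /tmin; rewrite pm.
Qed.

Lemma inf_nat_None p : inf_nat p = None <-> forall j, ~~ p j.
Proof.
rewrite /inf_nat; case: pselect => [[j pj]|h]; split=> //.
  by move=> /(_ j); rewrite pj.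
by move=> _ j; apply/negP => pj; apply: h; exists j.
Qed.

Lemma eq_inf_nat p q : p =1 q -> inf_nat p = inf_nat q.
Proof. by move=> /funext ->. Qed.

Lemma inf_nat_shift p q t : (forall j, (j < t)%N -> ~~ p j) ->
  (forall j, p (t + j)%N = q j) -> inf_nat p = omap (addn t) (inf_nat q).
Proof.
move=> pt pq; case qE : (inf_nat q) => [m|] /=.
  move/inf_nat_Some : qE => [qm qmin]; apply/inf_nat_Some; rewrite pq.
  split=> // j jm; have [/pt//|tj] := ltnP j t.
  by rewrite -(subnKC tj) pq; apply: qmin; lia.
move/inf_nat_None : qE => qN; apply/inf_nat_None => j.
have [/pt//|tj] := ltnP j t.
by rewrite -(subnKC tj) pq.
Qed.

End infimum.

Section words.
Implicit Types (x : nat) (s : seq nat).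

(** [s] lists the successive masses of a path that visits [-x] for the first time
    at its last step: a letter [n] moves the target from depth [y.+1] to depth
    [y + n]. *)
Fixpoint hit x s : bool :=
  match s, x with
  | [::], _ => x == 0
  | _ :: _, 0 => false
  | n :: s', y.+1 => hit (y + n) s'
  end.

Lemma hitP x s : reflect
  ((x + sumn s)%N = size s /\
   forall j, (j < size s)%N -> (j < x + sumn (take j s))%N)
  (hit x s).
Proof.
apply: (iffP idP).
  elim: s x => [|n s IH] [|x] //= /IH[h1 h2]; split; first lia.
  by case=> [//|j]; rewrite ltnS => /h2 /=; lia.
elim: s x => [|n s IH] [|x] /= [h1 h2]; [by []|lia| |].
  by have := h2 0%N erefl.
apply: IH; split; first lia.
by move=> j js; have := h2 j.+1 js => /=; lia.
Qed.

(** Minus the final level of the path with masses [s], when that level is not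
    positive. *)
Definition depth s : nat := (size s - sumn s)%N.

(** Defined by reversal, so that summing over these words is literally a sum over
    first-passage words; [negative_walkP] is the intended meaning. *)
Definition negative_walk s : bool := hit (depth s) (rev s).

Lemma negative_walkP s : reflect
  (forall j, (0 < j <= size s)%N -> (sumn (take j s) < j)%N) (negative_walk s).
Proof.
have sum_take j : (sumn (take j s) + sumn (drop j s))%N = sumn s.
  by rewrite -sumn_cat cat_take_drop.
have tk j : (j <= size s)%N ->
    sumn (take (size s - j) s) = (sumn s - sumn (take j (rev s)))%N.
  by move=> js; rewrite take_rev sumn_rev -(sum_take (size s - j)%N) addnK.
have le_rev j : (sumn (take j (rev s)) <= sumn s)%N.
  by rewrite -(sumn_rev s) -{2}(cat_take_drop j (rev s)) sumn_cat leq_addr.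
apply: (iffP (hitP _ _)); rewrite size_rev sumn_rev /depth.
  move=> [h1 h2] j /andP[j0 js].
  have := h2 (size s - j)%N ltac:(lia); have := tk (size s - j)%N ltac:(lia).
  by rewrite subKn// => ->; have := le_rev (size s - j)%N; lia.
move=> h; split.
  case: s h {sum_take tk le_rev} => [//|n s] h.
  by have := h (size (n :: s)); rewrite take_size leqnn => /(_ isT); lia.
move=> j js; have := h (size s - j)%N ltac:(lia).
by rewrite tk ?(ltnW js)//; have := le_rev j; lia.
Qed.

End words.

Section walk.
Context {R : realType}.
Implicit Types om : Omega R.

Definition word om (k n : nat) : seq nat :=
  [seq mass (Pof (om i%:Z)) | i <- iota k n].

Lemma size_word om k n : size (word om k n) = n.
Proof. by rewrite size_map size_iota. Qed.

Lemma take_word om k n j : (j <= n)%N -> take j (word om k n) = word om k j.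
Proof. by move=> jn; rewrite -map_take take_iota; congr map; congr iota; lia. Qed.

Lemma wordS om k n :
  word om k n.+1 = rcons (word om k n) (mass (Pof (om (k + n)%:Z))).
Proof. by rewrite /word -addn1 iotaD map_cat /= cats1. Qed.

Lemma SlukE om n : Sluk om n = (sumn (word om 0 n))%:Z - n%:Z.
Proof.
rewrite /Sluk; elim: n => [|n IH]; first by rewrite big_geq.
by rewrite big_nat_recr// IH wordS sumn_rcons add0n /=; lia.
Qed.

Lemma Sluk0 om : Sluk om 0 = 0. Proof. by rewrite SlukE. Qed.

Lemma SlukS om n : Sluk om n.+1 = Sluk om n + (mass (Pof (om n%:Z)))%:Z - 1.
Proof. by rewrite /Sluk big_nat_recr//= addrA. Qed.

Lemma Sluk_theta om t n :
  Sluk om (t + n)%N = Sluk om t + Sluk (theta t%:Z om) n.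
Proof.
elim: n => [|n IH]; first by rewrite addn0 Sluk0 addr0.
by rewrite addnS !SlukS IH /theta PoszD; lia.
Qed.

(** As the path descends by unit steps, not visiting [-x] before [t] means staying
    above [-x] before [t]. *)
Lemma tau_minus_hit om x t :
  tau_minus om x = Some t <-> hit x (word om 0 t).
Proof.
rewrite /tau_minus; split.
  move=> /inf_nat_Some[/eqP St tmin]; apply/hitP; rewrite size_word.
  split; first by move: St; rewrite SlukE; lia.
  have above j : (j < t)%N -> (- x%:Z < Sluk om j).
    elim: j => [|j IH] jt.
      by have := tmin 0%N jt; rewrite Sluk0; lia.
    have := tmin j.+1 jt; have := IH (ltnW jt).
    by rewrite SlukS; lia.
  by move=> j jt; have := above j jt; rewrite take_word ?(ltnW jt)// SlukE; lia.
move=> /hitP; rewrite size_word => -[St tmin]; apply/inf_nat_Some.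
split; first by rewrite SlukE; lia.
by move=> j jt; have := tmin j jt; rewrite take_word ?(ltnW jt)// SlukE; lia.
Qed.

(** The jump at time [t] ends the first excursion iff it brings the path from
    minus its depth back to a nonnegative level. *)
Lemma Tlad1P om t : Tlad om 1 = Some t.+1 <->
  negative_walk (word om 0 t) /\
  (depth (word om 0 t) < mass (Pof (om t%:Z)))%N.
Proof.
rewrite /= Sluk0.
have wS : negative_walk (word om 0 t) -> (sumn (word om 0 t) <= t)%N.
  case: t => [//|t] /negative_walkP /(_ t.+1).
  by rewrite size_word leqnn take_word// => /(_ isT); lia.
rewrite inf_nat_Some /= SlukS SlukE /depth size_word; split.
  move=> [h1 h2]; suff gw : negative_walk (word om 0 t).
    by split=> //; have := wS gw; lia.
  apply/negative_walkP => j; rewrite size_word => /andP[j0 jt].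
  by rewrite take_word//; have := h2 j; rewrite SlukE; lia.
move=> [gw h]; split; first by have := wS gw; lia.
move=> [//|j]; rewrite ltnS => jt; move/negative_walkP : gw => /(_ j.+1).
by rewrite size_word jt take_word// SlukE => /(_ isT); lia.
Qed.

Lemma Tlad1_gt0 om t : Tlad om 1 = Some t -> (0 < t)%N.
Proof. by rewrite /= => /inf_nat_Some[/andP[]]. Qed.

Lemma theta0 om : theta 0 om = om.
Proof. by apply/funext => k; rewrite /theta add0r. Qed.

Lemma theta_theta om (m n : int) : theta m (theta n om) = theta (n + m) om.
Proof. by apply/funext => k; rewrite /theta addrA. Qed.

Lemma Q1E om t : Tlad om 1 = Some t.+1 ->
  Q om 1 = upsilon (depth (word om 0 t)) (Pof (om t%:Z)).
Proof.
move=> T1; rewrite /Q /= theta0 /mu /zeta.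
have -> : tau om 0 = Some t.+1.
  rewrite -T1 /= /tau Sluk0; apply: eq_inf_nat => k; lia.
rewrite /=; congr upsilon; rewrite SlukE /depth size_word.
suff : (sumn (word om 0 t) <= t)%N by lia.
have [gw _] := (Tlad1P om t).1 T1.
case: t gw {T1} => [//|t] /negative_walkP /(_ t.+1).
by rewrite size_word leqnn take_word// => /(_ isT); lia.
Qed.

Lemma Tlad_shift om t k : Tlad om 1 = Some t ->
  Tlad om k.+1 = omap (addn t) (Tlad (theta t%:Z om) k).
Proof.
move=> T1; elim: k => [|k IH]; first by rewrite T1 /= addn0.
rewrite [LHS]/= -/(Tlad om k.+1) IH /=.
case: (Tlad _ k) => //= m; apply: inf_nat_shift => [j jt|j].
  by apply/negP => /andP[]; lia.
by rewrite !Sluk_theta lerD2l ltn_add2l.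
Qed.

Lemma excursions_shift om t i : Tlad om 1 = Some t ->
  Tlad (theta t%:Z om) i.+1 <> None ->
  excursions om i.+1 = excursions (theta t%:Z om) i.
Proof.
move=> T1 Ti; rewrite /excursions /Q !succnK !(Tlad_shift _ T1).
case E1 : (Tlad _ i.+1) Ti => [u|//] _.
case E2 : (Tlad _ i) => [v|] /=; last by move: E1; rewrite /= E2.
by rewrite subnDl theta_theta -PoszD.
Qed.

Definition excursions_in n (B : nat -> set (nat * ptmeas R)) : set (Omega R) :=
  [set om | forall i, (i < n)%N -> Tlad om i.+1 <> None /\ B i (excursions om i)].

(** Regeneration: levels, ladder times and marks after [T(1)] are those of the
    shifted sequence. *)
Lemma excursions_inS n B om : excursions_in n.+1 B om <->
  exists t, [/\ Tlad om 1 = Some t, B 0 (t, Q om 1) &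
    excursions_in n (fun i => B i.+1) (theta t%:Z om)].
Proof.
split.
  move=> h; case: (h 0%N erefl); case T1 : (Tlad om 1) => [t|//] _ B0.
  exists t; split=> //.
    by move: B0; rewrite /excursions T1 /= subn0.
  move=> i /= im; have [h1 h2] := h i.+1 im.
  have Ti : Tlad (theta t%:Z om) i.+1 <> None.
    by move=> Ti; apply: h1; rewrite (Tlad_shift _ T1) Ti.
  by split=> //; rewrite -(excursions_shift T1).
move=> [t [T1 B0 h]] [_|i im].
  by rewrite /excursions T1 [Tlad om 0]/= [odflt _ _]/= subn0.
have [h1 h2] := h i im; split; last by rewrite (excursions_shift T1).
by rewrite (Tlad_shift _ T1); case: Tlad h1.
Qed.

Lemma Tlad_NoneW om i j : (i <= j)%N -> Tlad om i = None -> Tlad om j = None.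
Proof.
by move=> ij Ti; rewrite -(subnKC ij); elim: (j - i)%N => [|k];
  rewrite ?addn0// addnS /= => ->.
Qed.

Lemma ltn_Gstop om k : ltn_inf k (Gstop om) <-> Tlad om k <> None.
Proof.
rewrite /Gstop; case E : (inf_nat _) => [m|] /=.
  move/inf_nat_Some : E => [/eqP Tm mmin]; split=> [/mmin /eqP//|Tk].
  by rewrite ltnNge; apply/negP => /Tlad_NoneW/(_ Tm).
by move/inf_nat_None : E => /(_ k)/eqP; split.
Qed.

End walk.

(** * Rectangles and the product formula for excursions *)

Section measurability_of_coordinates.
Context {R : realType}.

Lemma measurable_Pof : measurable_fun setT (@Pof R).
Proof.
move=> _ B mB; rewrite setTI; exists (snd @^-1` B); last by rewrite setTI.
by rewrite -[X in measurable X]setTI; exact: measurable_snd.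
Qed.

Lemma measurable_massPof (C : set nat) :
  measurable [set st : state R | C (mass (Pof st))].
Proof.
rewrite -[X in measurable X]setTI.
by apply: (measurableT_comp (@measurable_mass R) measurable_Pof).
Qed.

Lemma measurable_upsilonPof x (C : set (ptmeas R)) : measurable C ->
  measurable [set st : state R | C (upsilon x (Pof st))].
Proof.
move=> mC; rewrite -[X in measurable X]setTI.
by apply: (measurableT_comp (@measurable_upsilon R x) measurable_Pof).
Qed.

Lemma measurable_coordinate (I : Type) d (T : measurableType d) (i : I) :
  measurable_fun setT (fun x : power I T => x i).
Proof.
move=> _ B mB; rewrite setTI; apply: sub_sigma_algebra.
by exists i => //; exists B => //; rewrite setTI.
Qed.

Lemma measurable_power d (T : measurableType d) (I : Type) d'
    (T' : measurableType d') (X : T -> power I T') :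
  (forall i, measurable_fun setT (fun x => X x i)) -> measurable_fun setT X.
Proof.
move=> h.
apply: (@measurability _ _ T (power I T') setT X (@cylinders I _ T') erefl).
move=> _ [B [i _ [C mC <-]] <-]; rewrite !setTI -[X in measurable X]setTI.
exact: h.
Qed.

Lemma measurable_section (B : set (nat * ptmeas R)) t : measurable B ->
  measurable [set nu | B (t, nu)].
Proof.
by move=> mB; rewrite -[X in measurable X]setTI; exact: pair1_measurable.
Qed.

End measurability_of_coordinates.

Lemma esumZl (R : realType) (I : choiceType) (D : set I) (x : R)
    (f : I -> \bar R) : (0 <= x)%R -> (forall i, (0 <= f i)%E) ->
  (\esum_(i in D) (x%:E * f i) = x%:E * \esum_(i in D) f i)%E.
Proof.
have le y (g : I -> \bar R) : (0 <= y)%R -> (forall i, (0 <= g i)%E) ->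
    (\esum_(i in D) (y%:E * g i) <= y%:E * \esum_(i in D) g i)%E.
  move=> y0 g0; apply: ge_ereal_sup => _ [A [finA AD] <-].
  rewrite -ge0_mule_fsumr//.
  by rewrite lee_wpmul2l// ?lee_fin//; apply: ereal_sup_ubound; exists A.
move=> x0 f0; have [->|xn0] := eqVneq x 0%R.
  by rewrite mul0e esum1// => i _; rewrite mul0e.
have xp : (0 < x)%R by rewrite lt_neqAle eq_sym xn0.
apply/eqP; rewrite eq_le le//=.
have := le x^-1 (fun i => x%:E * f i)%E.
rewrite invr_ge0 x0 => /(_ isT (fun i => mule_ge0 _ (f0 i))).
rewrite lee_fin => /(_ x0); rewrite -(@lee_pmul2l _ x%:E)// ?lte_fin//.
rewrite muleA -EFinM mulfV// mul1e; under eq_esum do rewrite muleA -EFinM mulVf// mul1e.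
by [].
Qed.

(** For unions indexed by finite words. *)
Lemma measure_esum d (T : measurableType d) (R : realType)
    (m : {measure set T -> \bar R}) (I : countType) (D : set I)
    (F : I -> set T) :
  (forall i, D i -> measurable (F i)) -> trivIset D F ->
  measurable (\bigcup_(i in D) F i) /\
  m (\bigcup_(i in D) F i) = (\esum_(i in D) m (F i))%E.
Proof.
move=> mF tF.
pose D' : set nat := pickle @` D.
pose F' n := if unpickle n is Some i then F i else set0.
have F'E i : F' (pickle i) = F i by rewrite /F' pickleK.
have UE : \bigcup_(i in D) F i = \bigcup_(n in D') F' n.
  by rewrite bigcup_image; apply: eq_bigcupr => i _; rewrite F'E.
have mF' n : D' n -> measurable (F' n) by case=> i Di <-; rewrite F'E; exact: mF.
have tF' : trivIset D' F'.
  move=> _ _ [i Di <-] [j Dj <-]; rewrite !F'E => ij.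
  by rewrite (tF i j).
split; first by rewrite UE; exact: bigcup_measurable.
rewrite UE measure_bigcup// nneseries_esum//.
rewrite (_ : [set x | x \in D'] = D'); last first.
  by apply/seteqP; split=> x /=; rewrite inE.
rewrite esum_image; last by move=> i j _ _ /(pcan_inj pickleK).
by apply: eq_esum => i _; rewrite F'E.
Qed.

Section rectangles.
Context {R : realType}.
Variables (P : probability (Omega R) R) (lam : probability (state R) R).
Hypothesis P_indep : independent_family P (fun (n : int) (om : Omega R) => om n).
Hypothesis P_law : forall (n : int) A, measurable A ->
  P ((fun om : Omega R => om n) @^-1` A) = lam A.

Fixpoint rect (k : nat) (L : seq (set (state R))) : set (Omega R) :=
  if L is A :: L' then (fun om : Omega R => om k%:Z) @^-1` A `&` rect k.+1 L'
  else setT.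

Definition all_measurable (L : seq (set (state R))) : Prop :=
  forall i, measurable (nth setT L i).

Lemma measurable_rect k L : all_measurable L -> measurable (rect k L).
Proof.
elim: L k => [|A L IH] k mL /=; first exact: measurableT.
apply: measurableI; last by apply: IH => i; exact: mL i.+1.
rewrite -[X in measurable X]setTI.
by apply: (@measurable_coordinate int _ (state R)) => //; exact: mL 0%N.
Qed.

Lemma rect_cat k L1 L2 :
  rect k (L1 ++ L2) = rect k L1 `&` rect (k + size L1) L2.
Proof.
elim: L1 k => [|A L1 IH] k /=; first by rewrite addn0 setTI.
by rewrite IH setIA addSnnS.
Qed.

Lemma rect_bigsetI k L : rect k L = \big[setI/setT]_(i <- map Posz (iota k (size L)))
  ((fun om : Omega R => om i) @^-1` nth setT L (`|i|%N - k)).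
Proof.
elim: L k => [|A L IH] k /=; first by rewrite big_nil.
rewrite big_cons IH absz_nat subnn; congr setI.
rewrite !big_map big_seq [RHS]big_seq; apply: eq_bigr => i.
rewrite mem_iota => /andP[ki _]; congr preimage.
by rewrite absz_nat -(subnSK ki).
Qed.

Lemma P_rect k L : all_measurable L -> P (rect k L) = (\prod_(A <- L) lam A)%E.
Proof.
move=> mL; rewrite rect_bigsetI P_indep; last first.
- by move=> i; exact: mL.
- by rewrite map_inj_uniq ?iota_uniq// => i j [].
under eq_bigr do rewrite P_law//.
rewrite big_map -{1}[k]addn0 iotaDl big_map (big_nth setT) /index_iota subn0.
by apply: eq_bigr => i _; rewrite absz_nat addKn.
Qed.

Definition word_sets (s : seq nat) : seq (set (state R)) :=
  [seq [set st | mass (Pof st) = n] | n <- s].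

Definition word_weight (s : seq nat) : \bar R :=
  (\prod_(n <- s) lam [set st | mass (Pof st) = n])%E.

Lemma rect_word k s om :
  rect k (word_sets s) om <-> word om k (size s) = s.
Proof.
elim: s k => [|n s IH] k //=; rewrite /word/= -/(word om k.+1 (size s)).
by split=> [[-> /IH ->]//|[h1 h2]]; split=> //; apply/IH.
Qed.

(** The states that end an excursion from depth [x] with landing measure in
    [C]. *)
Definition jump_set x (C : set (ptmeas R)) : set (state R) :=
  [set st | (x < mass (Pof st))%N] `&` [set st | C (upsilon x (Pof st))].

Lemma measurable_jump_set x C : measurable C -> measurable (jump_set x C).
Proof.
move=> mC; apply: measurableI; first exact: (measurable_massPof [set n | (x < n)%N]).
exact: measurable_upsilonPof.
Qed.

Definition excursion_sets (B : set (nat * ptmeas R)) (s : seq nat) :=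
  rcons (word_sets s) (jump_set (depth s) [set nu | B ((size s).+1, nu)]).

Lemma all_measurable_rcons L A :
  all_measurable L -> measurable A -> all_measurable (rcons L A).
Proof.
move=> mL mA i; rewrite nth_rcons; case: ifP => [_|_]; first exact: mL.
by case: ifP.
Qed.

Lemma all_measurable_cat L1 L2 :
  all_measurable L1 -> all_measurable L2 -> all_measurable (L1 ++ L2).
Proof. by move=> m1 m2 i; rewrite nth_cat; case: ifP. Qed.

Lemma all_measurable_word s : all_measurable (word_sets s).
Proof.
move=> i; have [is_|is_] := ltnP i (size s); last first.
  by rewrite nth_default ?size_map.
rewrite (nth_map 0%N)//; exact: (measurable_massPof [set nth 0%N s i]).
Qed.

Lemma all_measurable_excursion B s : measurable B ->
  all_measurable (excursion_sets B s).
Proof.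
move=> mB; apply: all_measurable_rcons; first exact: all_measurable_word.
by apply: measurable_jump_set; exact: measurable_section.
Qed.

Lemma rect_theta k t L om : rect (k + t) L om <-> rect k L (theta t%:Z om).
Proof.
elim: L k => [|A L IH] k //=; rewrite -addSn /theta -PoszD addnC.
by split=> -[h1 /IH h2].
Qed.

(** The first excursion is read off from the word of masses preceding its last
    step; the rectangle indexed by this word is the corresponding event. *)
Lemma rect_excursion B s om :
  rect 0 (excursion_sets B s) om /\ negative_walk s <->
  word om 0 (size s) = s /\ Tlad om 1 = Some (size s).+1 /\
  B ((size s).+1, Q om 1).
Proof.
rewrite /excursion_sets -cats1 rect_cat /= size_map add0n; split.
  move=> [[/rect_word ws [[h1 h2] _]] gs].
  have T1 : Tlad om 1 = Some (size s).+1 by apply/Tlad1P; rewrite ws.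
  by rewrite (Q1E T1) ws.
move=> [ws [T1 BQ]]; have [gs ds] := (Tlad1P _ _).1 T1; rewrite ws in gs ds.
split=> //; split; first exact/rect_word.
by split=> //; split=> //; rewrite /= -[in depth _]ws -(Q1E T1).
Qed.

(** The law of [(T(1), Q(1))] restricted to [T(1) < oo], as a sum over the words
    that precede the last step of the first excursion. *)
Definition first_excursion_law (B : set (nat * ptmeas R)) : \bar R :=
  (\esum_(s in [set s | negative_walk s])
    (word_weight s * lam (jump_set (depth s) [set nu | B ((size s).+1, nu)])))%E.

Lemma word_weight_ge0 s : (0 <= word_weight s)%E.
Proof. by apply: prode_ge0 => n _; exact: measure_ge0. Qed.

Lemma first_excursion_law_ge0 B : (0 <= first_excursion_law B)%E.
Proof.
by apply: esum_ge0 => s _; rewrite mule_ge0 ?word_weight_ge0.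
Qed.

Lemma prod_excursion_sets B s : measurable B ->
  (\prod_(A <- excursion_sets B s) lam A =
   word_weight s * lam (jump_set (depth s) [set nu | B ((size s).+1, nu)]))%E.
Proof. by move=> mB; rewrite big_rcons/= big_map. Qed.

(** The rectangle [L] in front is what makes the induction work: cutting off the
    first excursion merely lengthens it. *)
Lemma P_excursions_in n (B : nat -> set (nat * ptmeas R)) L :
    (forall i, measurable (B i)) -> all_measurable L ->
  let E := rect 0 L `&` theta (size L)%:Z @^-1` excursions_in n B in
  measurable E /\
  P E = ((\prod_(A <- L) lam A) * \prod_(i < n) first_excursion_law (B i))%E.
Proof.
elim: n B L => [|n IH] B L mB mL /=.
  rewrite (_ : theta _ @^-1` _ = setT); last by apply/seteqP; split.
  rewrite setIT big_ord0 mule1; split; first exact: measurable_rect.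
  exact: P_rect.
pose L' s := L ++ excursion_sets (B 0) s.
pose F s := rect 0 (L' s) `&`
  theta (size (L' s))%:Z @^-1` excursions_in n (fun i => B i.+1).
have sL' s : size (L' s) = (size L + (size s).+1)%N.
  by rewrite size_cat size_rcons size_map.
have FP s om : F s om <-> rect 0 L om /\
    (rect 0 (excursion_sets (B 0%N) s) (theta (size L)%:Z om) /\
     excursions_in n (fun i => B i.+1)
       (theta (size s).+1%:Z (theta (size L)%:Z om))).
  rewrite /F /= rect_cat sL' theta_theta -PoszD; split.
    by move=> [[h1 h2] h3]; split=> //; split=> //; apply/rect_theta.
  by move=> [h1 [h2 h3]]; split=> //; split=> //; apply/rect_theta.
have -> : rect 0 L `&` theta (size L) @^-1` excursions_in n.+1 B =
    \bigcup_(s in [set s | negative_walk s]) F s.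
  apply/seteqP; split=> om /=.
    move=> [Lom] /excursions_inS[[|t] [T1 B0 En]].
      by have := Tlad1_gt0 T1.
    have [gw _] := (Tlad1P _ _).1 T1.
    exists (word (theta (size L)%:Z om) 0 t) => //.
    apply/FP; split=> //; rewrite size_word; split=> //.
    by apply: ((rect_excursion _ _ _).2 _).1; rewrite size_word.
  move=> [s gs /FP[Lom [h1 h2]]]; split=> //; apply/excursions_inS.
  by have [ws [T1 BQ]] := (rect_excursion _ _ _).1 (conj h1 gs); exists (size s).+1.
have mL' s : all_measurable (L' s).
  by apply: all_measurable_cat => //; exact: all_measurable_excursion.
have mF s : measurable (F s).
  by have [] := IH (fun i => B i.+1) (L' s) (fun i => mB i.+1) (mL' s).
have PF s : P (F s) =
   ((\prod_(A <- L) lam A) * (\prod_(i < n) first_excursion_law (B i.+1)) *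
   (word_weight s * lam (jump_set (depth s) [set nu | B 0%N ((size s).+1, nu)])))%E.
  have [_ ->] := IH (fun i => B i.+1) (L' s) (fun i => mB i.+1) (mL' s).
  by rewrite big_cat/= prod_excursion_sets// muleAC.
(* [T(1)] and the masses before it determine the word. *)
have tF : trivIset [set s | negative_walk s] F.
  move=> s s' gs gs' [om [/FP[_ [h _]] /FP[_ [h' _]]]].
  have [ws [T1 _]] := (rect_excursion _ _ _).1 (conj h gs).
  have [ws' [T1' _]] := (rect_excursion _ _ _).1 (conj h' gs').
  by move: T1'; rewrite T1 => -[ss]; rewrite -ws ss.
have [mU ->] := measure_esum P (fun s _ => mF s) tF; split=> //.
rewrite big_ord_recl/= [X in (_ * X)%E]muleC muleA (eq_esum (fun s _ => PF s)).
(* Finiteness is needed to take the factor out of the sum. *)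
have fin : ((\prod_(A <- L) lam A) *
    \prod_(i < n) first_excursion_law (B i.+1))%E \is a fin_num.
  have [mE <-] := IH (fun i => B i.+1) L (fun i => mB i.+1) mL.
  by rewrite fin_num_measure.
rewrite -(fineK fin) esumZl// => [|s].
  by rewrite fine_ge0// mule_ge0// prode_ge0// => i _; rewrite ?first_excursion_law_ge0.
by rewrite mule_ge0// word_weight_ge0.
Qed.

Lemma P_excursions n (B : nat -> set (nat * ptmeas R)) :
    (forall i, measurable (B i)) ->
  measurable (excursions_in n B) /\
  P (excursions_in n B) = (\prod_(i < n) first_excursion_law (B i))%E.
Proof.
move=> mB; have mnil : all_measurable [::] by move=> i; rewrite nth_nil.
have := P_excursions_in n mB mnil; rewrite /= setTI big_nil mul1e.
rewrite (_ : theta 0%:Z @^-1` _ = excursions_in n B)//.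
by apply/seteqP; split=> om; rewrite /preimage /= theta0.
Qed.

Lemma P_tau_minus x t :
  measurable [set om : Omega R | tau_minus om x = Some t] /\
  P [set om | tau_minus om x = Some t] =
    (\esum_(s in [set s | hit x s /\ size s = t]) word_weight s)%E.
Proof.
pose D := [set s : seq nat | hit x s /\ size s = t].
have -> : [set om : Omega R | tau_minus om x = Some t] =
    \bigcup_(s in D) rect 0 (word_sets s).
  apply/seteqP; split=> om /=; rewrite tau_minus_hit.
    move=> h; exists (word om 0 t); first by split=> //; rewrite size_word.
    by apply/rect_word; rewrite size_word.
  by case=> s [hs st] /rect_word; rewrite st => ->.
have tD : trivIset D (fun s => rect 0 (word_sets s)).
  by move=> s s' [_ ss] [_ ss'] [om [/rect_word + /rect_word]]; rewrite ss ss' => <-.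
have mw s : measurable (rect 0 (word_sets s)).
  by apply: measurable_rect; exact: all_measurable_word.
have [mU ->] := measure_esum P (fun s _ => mw s) tD; split=> //.
apply: eq_esum => s _; apply: etrans (P_rect 0 (all_measurable_word s)) _.
by rewrite big_map.
Qed.

End rectangles.

(** * The probability of a first excursion *)

Section rearrangements_of_sums.
Context {R : realType}.
Local Open Scope ereal_scope.

Lemma esum_fibers (I J : choiceType) (D : set I) (f : I -> J)
    (a : I -> \bar R) : (forall i, 0 <= a i) ->
  \esum_(i in D) a i = \esum_(j in setT) \esum_(i in D `&` f @^-1` [set j]) a i.
Proof.
move=> a0; rewrite esum_esum//=.
rewrite (@reindex_esum R _ _ D _ (fun i => (f i, i)))//.
split=> [i Di /=|i i' _ _ [_ ->]//|[j i] [/= _ [Di fi]]]; first by split.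
by exists i => //; rewrite fi.
Qed.

Lemma esum_exchange (I J : choiceType) (A : set I) (B : I -> set J)
    (B' : set J) (A' : J -> set I) (a : I -> J -> \bar R) :
    (forall i j, 0 <= a i j) -> (forall i j, A i /\ B i j <-> B' j /\ A' j i) ->
  \esum_(i in A) \esum_(j in B i) a i j =
  \esum_(j in B') \esum_(i in A' j) a i j.
Proof.
move=> a0 ABE; rewrite !esum_esum//.
rewrite (@reindex_esum R _ _ (B' `*`` A') _ (fun k => (k.2, k.1)))//.
split=> [[j i] /ABE//|[j i] [j' i'] _ _ [-> ->]//|[i j] /ABE ?].
by exists (j, i).
Qed.

Lemma esum_telescope (u : nat -> R) (l : R) :
  (forall n, u n.+1 <= u n)%R -> u @ \oo --> l ->
  \esum_(n in setT) ((u n - u n.+1)%R)%:E = (u 0%N - l)%:E.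
Proof.
move=> du ul; rewrite -nneseries_esumT; last first.
  by move=> n; rewrite lee_fin subr_ge0.
apply/cvg_lim => //.
rewrite (_ : (fun n => _) = (fun n => (u 0%N - u n)%:E)); last first.
  apply/funext => n; rewrite sumEFin; congr EFin.
  elim: n => [|n IH]; first by rewrite big_geq// subrr.
  by rewrite big_nat_recr//= IH addrA subrK.
by apply: cvg_EFin; [exact: nearW|apply: cvgB => //; exact: cvg_cst].
Qed.

End rearrangements_of_sums.

Section passage_below.
Context {R : realType}.
Variables (P : probability (Omega R) R) (lam : probability (state R) R).
Hypothesis P_indep : independent_family P (fun (n : int) (om : Omega R) => om n).
Hypothesis P_law : forall (n : int) A, measurable A ->
  P ((fun om : Omega R => om n) @^-1` A) = lam A.
Local Open Scope ereal_scope.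

Definition hit_prob (x : nat) : \bar R :=
  \esum_(s in [set s | hit x s]) word_weight lam s.

Lemma hit_probE x :
  measurable [set om : Omega R | tau_minus om x <> None] /\
  P [set om | tau_minus om x <> None] = hit_prob x.
Proof.
have -> : [set om : Omega R | tau_minus om x <> None] =
    \bigcup_(s in [set s | hit x s]) rect 0 (word_sets s).
  apply/seteqP; split=> om /=.
    case E : (tau_minus om x) => [t|//] _; move/tau_minus_hit : E => h.
    by exists (word om 0 t) => //; apply/rect_word; rewrite size_word.
  case=> s /= hs /rect_word ws; have : tau_minus om x = Some (size s).
    by apply/tau_minus_hit; rewrite ws.
  by move=> ->.
have tD : trivIset [set s | hit x s] (fun s => rect (R := R) 0 (word_sets s)).
  move=> s s' /= hs hs' [om [/rect_word ws /rect_word ws']].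
  have := (tau_minus_hit om x (size s)).2; rewrite ws => /(_ hs) E.
  have := (tau_minus_hit om x (size s')).2; rewrite ws' => /(_ hs').
  by rewrite E => -[ss]; rewrite -ws -ws' ss.
have mw s : measurable (rect (R := R) 0 (word_sets s)).
  by apply: measurable_rect; exact: all_measurable_word.
have [mU ->] := measure_esum P (fun s _ => mw s) tD; split=> //.
apply: eq_esum => s _.
apply: etrans (P_rect P_indep P_law 0 (all_measurable_word s)) _.
by rewrite big_map.
Qed.

Lemma hit_prob_ge0 x : 0 <= hit_prob x.
Proof. by rewrite -(hit_probE x).2. Qed.

Lemma hit_prob_le1 x : hit_prob x <= 1.
Proof. by have [mx <-] := hit_probE x; exact: probability_le1. Qed.

(** The path cannot jump over [-x] on its way to [-x.+1]. *)
Lemma hit_prob_nonincreasing x : hit_prob x.+1 <= hit_prob x.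
Proof.
have [mx <-] := hit_probE x; have [mx' <-] := hit_probE x.+1.
apply: le_measure; rewrite ?inE// => om /=; apply: contra_not.
move=> /inf_nat_None no_hit; apply/inf_nat_None => t.
suff above j : (- x%:Z < Sluk om j)%R by have := above t; lia.
elim: j => [|j IH].
  by have := no_hit 0%N; rewrite Sluk0; lia.
by have := no_hit j.+1; rewrite SlukS; lia.
Qed.

Lemma hit_prob0 : hit_prob 0 = 1.
Proof.
rewrite /hit_prob (_ : [set s | hit 0 s] = [set [::]]); last first.
  by apply/seteqP; split=> -[|n s].
by rewrite esum_set1 /word_weight ?big_nil.
Qed.

Definition offspring n : \bar R := lam [set st | mass (Pof st) = n].

Definition tail j : \bar R := lam [set st | (j < mass (Pof st))%N].

Lemma lam_mass (C : set nat) :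
  lam [set st | C (mass (Pof st))] = \esum_(n in C) offspring n.
Proof.
have -> : [set st : state R | C (mass (Pof st))] =
    \bigcup_(n in C) [set st | mass (Pof st) = n].
  apply/seteqP; split=> [st Cst|st [n Cn /= ->]//].
  by exists (mass (Pof st)).
apply: (measure_esum lam _ _).2 => [n _|].
  exact: (measurable_massPof [set n]).
by move=> n n' _ _ [st [/= <- <-]].
Qed.

(** Decomposes a first-passage word according to its first letter. *)
Lemma hit_prob_step x :
  hit_prob x.+1 = \esum_(n in setT) offspring n * hit_prob (x + n).
Proof.
rewrite /hit_prob (esum_fibers _ (head 0%N)); last exact: word_weight_ge0.
apply: eq_esum => n _.
have fin : offspring n \is a fin_num.
  by rewrite fin_num_measure//; exact: (measurable_massPof [set n]).
rewrite -(fineK fin) -esumZl; last first.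
- by move=> s; exact: word_weight_ge0.
- by rewrite fine_ge0.
rewrite (@reindex_esum R _ _ [set s | hit (x + n) s] _ (cons n)).
  by apply: eq_esum => s _; rewrite (fineK fin) /word_weight big_cons.
split=> [s /= hs|s s' _ _ [->]//|[|m s] [/= hs <-]//]; first by [].
by exists s.
Qed.

Lemma tail_ge0 j : 0 <= tail j. Proof. exact: measure_ge0. Qed.

Lemma tail_fin_num j : tail j \is a fin_num.
Proof. by rewrite fin_num_measure//; exact: (measurable_massPof [set n | (j < n)%N]). Qed.

Lemma offspring_fin_num n : offspring n \is a fin_num.
Proof. by rewrite fin_num_measure//; exact: (measurable_massPof [set n]). Qed.

Lemma esumZr (I : choiceType) (D : set I) (f : I -> \bar R) (x : R) :
  (0 <= x)%R -> (forall i, 0 <= f i) ->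
  \esum_(i in D) f i * x%:E = (\esum_(i in D) f i) * x%:E.
Proof.
move=> x0 f0; rewrite muleC -esumZl//.
by apply: eq_esum => i _; rewrite muleC.
Qed.

Let H x : R := fine (hit_prob x).

Let HE x : (H x)%:E = hit_prob x.
Proof.
rewrite fineK// ge0_fin_numE ?hit_prob_ge0//.
by apply: le_lt_trans (hit_prob_le1 x) _; rewrite ltry.
Qed.

Let H_nonincreasing x : (H x.+1 <= H x)%R.
Proof. by rewrite -lee_fin !HE; exact: hit_prob_nonincreasing. Qed.

Let d x : R := (H x - H x.+1)%R.

Let d_ge0 x : (0 <= d x)%R. Proof. by rewrite subr_ge0. Qed.

(** Expand [hit_prob x] as the [offspring]-average of the constant [hit_prob x],
    write it as [hit_prob (x + n)] plus the [n] differences in between, and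
    recognize [hit_prob x.+1] by conditioning on the first step. *)
Lemma hit_prob_diff x :
  (d x)%:E = \esum_(j in setT) tail j * (d (x + j))%:E.
Proof.
have off0 n : 0 <= offspring n by exact: measure_ge0.
have tele n : H x = (H (x + n) + \sum_(j < n) d (x + j))%R.
  elim: n => [|n IH]; first by rewrite big_ord0 addn0 addr0.
  by rewrite big_ord_recr/= [LHS]IH /d addnS; lra.
have : (H x)%:E = (H x.+1)%:E + \esum_(j in setT) tail j * (d (x + j))%:E.
  rewrite {1}(_ : (H x)%:E = \esum_(n in setT) (offspring n * (H x)%:E)); last first.
    rewrite esumZr//; last by rewrite -lee_fin HE hit_prob_ge0.
    by rewrite -lam_mass (_ : [set st | _] = setT)// probability_setT mul1e.
  rewrite [X in _ = X + _]HE hit_prob_step.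
  under eq_esum => n _.
    rewrite (tele n) EFinD muleDr ?offspring_fin_num ?fin_num_adde_defl//.
    rewrite HE -sumEFin.
    over.
  rewrite esumD; last 2 first.
  - by move=> n _; rewrite mule_ge0// hit_prob_ge0.
  - by move=> n _; rewrite mule_ge0// sume_ge0// => j _; rewrite lee_fin.
  congr (_ + _).
  transitivity (\esum_(n in setT) \esum_(j in `I_n)
      (offspring n * (d (x + j))%:E)).
    apply: eq_esum => n _; rewrite -(fineK (offspring_fin_num n)).
    rewrite esumZl ?fine_ge0//; last by move=> j; rewrite lee_fin.
    congr (_ * _); rewrite esum_fset; first exact: (fsbig_ord _ n (fun j => (d (x + j))%:E)).
    - exact: finite_II.
    - by move=> j _; rewrite lee_fin.
  rewrite (@esum_exchange _ _ _ _ (fun n => `I_n) setT (fun j => [set n | (j < n)%N])).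
  - apply: eq_esum => j _; rewrite esumZr//; congr (_ * _).
    by rewrite -(lam_mass [set n | (j < n)%N]).
  - by move=> n j; rewrite mule_ge0// lee_fin.
  - by move=> n j /=; split=> -[].
by move=> e; rewrite {1}/d EFinB e addeAC subee// add0e.
Qed.

(** Summing [hit_prob_diff] over [x] telescopes and gives, for the limit [l] of
    the hitting probabilities, [1 - l <= m (1 - l)]. So [l = 1] or [m = 1], and
    the sum, equal to [(1 - l) + m l], is [m] in both cases. *)
Lemma tail_hit_prob : \esum_(j in setT) tail j <= 1 ->
  \esum_(j in setT) tail j * hit_prob j = \esum_(j in setT) tail j.
Proof.
set m := \esum_(j in setT) tail j => m1.
have m0 : 0 <= m by apply: esum_ge0 => j _; exact: tail_ge0.
have mfin : m \is a fin_num.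
  by rewrite ge0_fin_numE//; apply: le_lt_trans m1 _; rewrite ltry.
have [l Hl l0] : exists2 l, H @ \oo --> l & (0 <= l)%R.
  have H0 x : (0 <= H x)%R by rewrite fine_ge0// hit_prob_ge0.
  have cH : cvgn H.
    apply: nonincreasing_is_cvgn; last by exists 0%R => _ [x _ <-].
    by apply/nonincreasing_seqP.
  by exists (limn H) => //; apply: limr_ge => //; exact: nearW.
have lH j : (l <= H j)%R.
  rewrite -(cvg_lim _ Hl)//; apply: nonincreasing_cvgn_ge => //.
    exact/nonincreasing_seqP.
  by apply/cvg_ex; exists l.
have key : (1 - l)%:E = \esum_(j in setT) tail j * (H j - l)%:E.
  have H0 : H 0%N = 1%R by rewrite /H hit_prob0.
  rewrite -{1}H0 -(esum_telescope H_nonincreasing Hl).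
  under eq_esum do rewrite -/(d _) hit_prob_diff.
  rewrite (@esum_exchange _ _ _ _ (fun=> setT) setT (fun=> setT)).
  - apply: eq_esum => j _; rewrite -(fineK (tail_fin_num j)) esumZl.
    + congr (_ * _); have := @esum_telescope R (fun n => H (n + j)%N) l.
      rewrite add0n => <- //; last by rewrite cvg_shiftn.
      by move=> n; rewrite addSn.
    + by rewrite fine_ge0// tail_ge0.
    + by move=> i; rewrite lee_fin.
  - by move=> i j; rewrite mule_ge0 ?tail_ge0// lee_fin.
  - by [].
have sumE : \esum_(j in setT) tail j * hit_prob j = (1 - l)%:E + m * l%:E.
  rewrite key -esumZr//.
  rewrite -esumD; last 2 first.
  - by move=> j _; rewrite mule_ge0 ?tail_ge0// lee_fin subr_ge0.
  - by move=> j _; rewrite mule_ge0 ?tail_ge0// lee_fin.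
  apply: eq_esum => j _.
  by rewrite -muleDr -?EFinD ?subrK ?HE// ?fin_num_adde_defl// tail_fin_num.
have l1 : (l <= 1)%R by apply: le_trans (lH 0%N) _; rewrite -lee_fin HE hit_prob_le1.
have key_le : (1 - l)%:E <= m * (1 - l)%:E.
  rewrite [leLHS]key -esumZr ?subr_ge0//.
  apply: le_esum => j _; rewrite lee_wpmul2l ?tail_ge0// lee_fin lerD2r.
  by rewrite -lee_fin HE hit_prob_le1.
rewrite sumE; move: key_le m1; rewrite -(fineK mfin) -!EFinM -EFinD !lee_fin.
move=> h1 h2; congr EFin; have : (0 <= (1 - l) * (1 - fine m))%R.
  by rewrite mulr_ge0 ?subr_ge0.
lra.
Qed.

End passage_below.

(** * The excursion law *)

Section first_excursion.
Context {R : realType}.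
Variables (P : probability (Omega R) R) (lam : probability (state R) R).
Hypothesis P_indep : independent_family P (fun (n : int) (om : Omega R) => om n).
Hypothesis P_law : forall (n : int) A, measurable A ->
  P ((fun om : Omega R => om n) @^-1` A) = lam A.
Local Open Scope ereal_scope.

Lemma word_weight_rev s : word_weight lam (rev s) = word_weight lam s.
Proof. by rewrite /word_weight; apply: perm_big; rewrite perm_rev. Qed.

Lemma depth_hit x s : hit x s -> depth s = x.
Proof. by move=> /hitP[h _]; rewrite /depth; lia. Qed.

Lemma depth_rev s : depth (rev s) = depth s.
Proof. by rewrite /depth size_rev sumn_rev. Qed.

(** Reversing a word exchanges staying negative until depth [x] and visiting
    [-x] for the first time at the end, and preserves the weight. *)
Lemma time_reversal x t :
  \esum_(s in [set s | negative_walk s] `&` size @^-1` [set t] `&`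
    depth @^-1` [set x]) word_weight lam s =
  P [set om | tau_minus om x = Some t].
Proof.
rewrite (P_tau_minus P_indep P_law x t).2.
rewrite (@reindex_esum R _ _ [set s | hit x s /\ size s = t] _ rev).
  by apply: eq_esum => s _; rewrite word_weight_rev.
split=> [s [/= hs st]|s s' _ _ /(can_inj revK)//|s [[/= gs st] ds]].
  split; first split=> /=; rewrite ?size_rev//; last by rewrite depth_rev (depth_hit hs).
  by rewrite /negative_walk depth_rev revK (depth_hit hs).
by exists (rev s); [rewrite /= size_rev -ds|rewrite revK].
Qed.

(** Words are sorted by length, which is [T(1) - 1], and by depth. *)
Lemma first_excursion_law_passage (B : set (nat * ptmeas R)) : measurable B ->
  first_excursion_law lam B = \esum_(t in setT) \esum_(x in setT)
    lam (jump_set x [set nu | B (t.+1, nu)]) * P [set om | tau_minus om x = Some t].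
Proof.
move=> mB; pose F s := word_weight lam s *
  lam (jump_set (depth s) [set nu | B ((size s).+1, nu)]).
have F0 s : 0 <= F s by rewrite mule_ge0 ?word_weight_ge0.
rewrite /first_excursion_law (esum_fibers _ size)//; apply: eq_esum => t _.
rewrite (esum_fibers _ depth)//; apply: eq_esum => x _.
rewrite -time_reversal; set c := lam _.
have cfin : c \is a fin_num.
  by rewrite fin_num_measure//; apply: measurable_jump_set; exact: measurable_section.
rewrite -(fineK cfin) -esumZl; last 2 first.
- by rewrite fine_ge0// /c measure_ge0.
- by move=> s; exact: word_weight_ge0.
by apply: eq_esum => s [[_ /= st] ds]; rewrite fineK// muleC /c -st -ds.
Qed.

End first_excursion.

Lemma integral_mrestr d (T : measurableType d) (R : realType)
    (m : {measure set T -> \bar R}) (D : set T) (mD : measurable D)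
    (f : T -> \bar R) : measurable_fun setT f -> (forall x, (0 <= f x)%E) ->
  (\int[mrestr m mD]_x f x = \int[m]_(x in D) f x)%E.
Proof.
move=> mf f0; have mDC := measurableC mD.
rewrite -(setUv D) ge0_integral_setU//; last 2 first.
- by rewrite setUv.
- by apply/disj_setPS => x [].
rewrite [X in (_ + X)%E](_ : _ = 0%E) ?adde0.
  by apply: eq_measure_integral => A mA AD; rewrite /= /mrestr setIidl.
apply: null_set_integral => //.
  exact: measurable_funS mf.
by rewrite /= /mrestr setICl measure0.
Qed.

Section excursion_measure.
Context {R : realType} d0 (W0 : measurableType d0) (P0 : probability W0 R)
  (VP : {RV P0 >-> state R}) (P : probability (Omega R) R).
Local Open Scope ereal_scope.

Let lam : probability (state R) R := distribution P0 VP.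

Let mVP : measurable_fun setT VP. Proof. exact: measurable_funPT. Qed.

Let N (w : W0) : nat := mass (Pof (VP w)).

Let measurable_N (C : set nat) : measurable (N @^-1` C).
Proof.
rewrite -[X in measurable X]setTI.
exact: (mVP measurableT (measurable_massPof C)).
Qed.

Lemma mean_massE : mean_mass P0 VP = \esum_(j in setT) tail lam j.
Proof.
rewrite /mean_mass unlock -nneseries_esumT; last by move=> j; exact: tail_ge0.
pose f j w : \bar R := (\1_[set w | (j < N w)%N] w)%:E.
transitivity (\int[P0]_w \sum_(0 <= j <oo) f j w).
  apply: eq_integral => w _.
  rewrite nneseries_esumT; last by move=> j; rewrite lee_fin.
  rewrite (_ : \esum_(j in setT) f j w = \esum_(j in `I_(N w)) 1); last first.
    rewrite [RHS]esum_mkcond; apply: eq_esum => j _.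
    rewrite /f indicE.
    have -> : (w \in [set w | (j < N w)%N]) = (j < N w)%N.
      by apply/idP/idP => [/set_mem//|?]; exact: mem_set.
    have -> : (j \in `I_(N w)) = (j < N w)%N.
      by apply/idP/idP => [/set_mem//|?]; exact: mem_set.
    by case: ltnP.
  rewrite esum_fset//.
  by rewrite -(fsbig_ord _ (N w) (fun=> 1)) sumEFin sumr_const card_ord.
rewrite integral_nneseries//; last 2 first.
- move=> j; apply/measurable_EFinP; apply: measurable_indic.
  exact: (measurable_N [set n | (j < n)%N]).
- by move=> j w _; rewrite lee_fin.
apply: eq_eseriesr => j _; rewrite /f integral_indic ?setIT//.
exact: (measurable_N [set n | (j < n)%N]).
Qed.

Let jump x : set W0 := [set w | (x < N w)%N].

Let mjump x : measurable (jump x). Proof. exact: (measurable_N [set n | (x < n)%N]). Qed.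

Let landing x w : ptmeas R := upsilon x (Pof (VP w)).

Let mlanding x : measurable_fun setT (landing x).
Proof.
move=> _ C mC; rewrite setTI -[X in measurable X]setTI.
exact: (mVP measurableT (measurable_upsilonPof x mC)).
Qed.

Let mpoint t x : measurable_fun setT (fun w => (t.+1, landing x w)).
Proof. exact: measurable_fun_pair. Qed.

Let passage x t : {nonneg R} :=
  NngNum (fine_ge0 (measure_ge0 P [set om | tau_minus om x = Some t])).

Let landing_law t x : {measure set (nat * ptmeas R) -> \bar R} :=
  measure_function_pushforward__canonical__measure_function_Measure
    (mrestr P0 (mjump x)) (mpoint t x).

(** The right-hand side of the formula for the excursion law, without the
    normalization, is the integral against a mixture of images of [P0]
    restricted to the events [jump x]. *)
Definition unnormalized_excursion : {measure set (nat * ptmeas R) -> \bar R} :=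
  mseries (fun t => mseries (fun x => mscale (passage x t) (landing_law t x)) 0) 0.

Hypothesis P_indep : independent_family P (fun (n : int) (om : Omega R) => om n).
Hypothesis P_law : forall (n : int) A, measurable A ->
  P ((fun om : Omega R => om n) @^-1` A) = lam A.

Lemma integral_unnormalized_excursion (F : nat * ptmeas R -> \bar R) :
  measurable_fun setT F -> (forall z, 0 <= F z) ->
  \int[unnormalized_excursion]_z F z =
  \sum_(0 <= t <oo) \sum_(0 <= x <oo) P [set om | tau_minus om x = Some t] *
    \int[P0]_(w in jump x) F (t.+1, landing x w).
Proof.
move=> mF F0; rewrite ge0_integral_measure_series//; apply: eq_eseriesr => t _.
rewrite ge0_integral_measure_series//; apply: eq_eseriesr => x _.
rewrite ge0_integral_mscale//= fineK; last first.
  by rewrite fin_num_measure//; exact: (P_tau_minus P_indep P_law x t).1.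
congr (_ * _); rewrite (ge0_integral_pushforward (mpoint t x))// preimage_setT.
rewrite integral_mrestr//; first exact: measurableT_comp.
by move=> w; exact: F0.
Qed.

Lemma unnormalized_excursionE B : measurable B ->
  unnormalized_excursion B = first_excursion_law lam B.
Proof.
move=> mB; rewrite (first_excursion_law_passage P_indep P_law)//.
have mj x t : measurable (jump_set x [set nu | B (t.+1, nu)]).
  by apply: measurable_jump_set; exact: measurable_section.
rewrite -nneseries_esumT; last first.
  by move=> t; apply: esum_ge0 => x _; rewrite mule_ge0.
rewrite /= /mseries; apply: eq_eseriesr => t _.
rewrite -nneseries_esumT; last by move=> x; rewrite mule_ge0.
rewrite /= /mseries; apply: eq_eseriesr => x _.
rewrite /= /mscale /= fineK ?fin_num_measure//; last first.
  exact: (P_tau_minus P_indep P_law x t).1.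
rewrite muleC; congr (_ * _); rewrite /pushforward /mrestr; congr (P0 _).
by rewrite setIC.
Qed.

Hypothesis mean_pos : 0 < mean_mass P0 VP.
Hypothesis mean_le1 : mean_mass P0 VP <= 1.

Let m : R := fine (mean_mass P0 VP).

Lemma fine_mean_gt0 : (0 < m)%R.
Proof. by rewrite fine_gt0// mean_pos (le_lt_trans mean_le1)// ltry. Qed.

Lemma mean_mass_fineK : m%:E = mean_mass P0 VP.
Proof. by rewrite fineK// gt0_fin_numE// (le_lt_trans mean_le1)// ltry. Qed.

(** With [B = setT] the double series is the sum of [tail x * hit_prob x]. *)
Lemma first_excursion_law_setT : first_excursion_law lam setT = mean_mass P0 VP.
Proof.
rewrite (first_excursion_law_passage P_indep P_law)//.
rewrite (@esum_exchange _ _ _ _ (fun=> setT) setT (fun=> setT)); last 2 first.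
- by move=> t x; rewrite mule_ge0.
- by [].
rewrite mean_massE -(tail_hit_prob P_indep P_law); last by rewrite -mean_massE.
apply: eq_esum => x _.
have jE t : jump_set x [set nu : ptmeas R | setT (t.+1, nu)] =
    [set st | (x < mass (Pof st))%N].
  by apply/seteqP; split=> st // [].
under eq_esum do rewrite jE -/(tail lam x) -(fineK (tail_fin_num lam x)).
rewrite esumZl ?fine_ge0 ?tail_ge0// (fineK (tail_fin_num lam x)); congr (_ * _).
rewrite /hit_prob (esum_fibers _ size); last exact: word_weight_ge0.
by apply: eq_esum => t _; rewrite (P_tau_minus P_indep P_law x t).2.
Qed.

Lemma exists_excursion_law : exists kappa : probability (nat * ptmeas R)%type R,
  is_excursion_law P0 VP P kappa /\
  forall B, measurable B -> m%:E * kappa B = first_excursion_law lam B.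
Proof.
have im0 : (0 <= m^-1)%R by rewrite invr_ge0 ltW// fine_mean_gt0.
pose k : {measure set (nat * ptmeas R) -> \bar R} :=
  mscale (NngNum im0) unnormalized_excursion.
have kE B : measurable B -> k B = (m^-1)%:E * first_excursion_law lam B.
  by move=> mB; rewrite -unnormalized_excursionE.
have kT : k setT = 1.
  rewrite kE// first_excursion_law_setT -mean_mass_fineK -EFinM mulVf//.
  by rewrite gt_eqF// fine_mean_gt0.
pose kappa : probability (nat * ptmeas R)%type R :=
  HB.pack (k : set _ -> \bar R) (Measure.on k)
    (@Measure_isProbability.Build _ _ _ k kT).
exists kappa; split; last first.
  move=> B mB; rewrite [kappa B]kE// muleA -EFinM mulfV ?mul1e//.
  by rewrite gt_eqF// fine_mean_gt0.
move=> f g [mf f0 _] [mg g0 _]; rewrite unlock.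
have mF : measurable_fun setT (fun z : nat * ptmeas R => (f z.2 * g z.1)%:E).
  apply/measurable_EFinP; apply: measurable_funM.
    exact: (measurableT_comp mf measurable_snd).
  exact: (measurableT_comp mg measurable_fst).
have F0 (z : nat * ptmeas R) : 0 <= (f z.2 * g z.1)%:E.
  by rewrite lee_fin mulr_ge0.
transitivity (\int[k]_z (f z.2 * g z.1)%:E); first by [].
rewrite ge0_integral_mscale//= integral_unnormalized_excursion//.
congr (_ * _); rewrite -(nneseries_addn 1); last first.
  move=> t; apply: nneseries_ge0 => x _ _; rewrite !mule_ge0// ?lee_fin//.
  by apply: integral_ge0 => w _; rewrite lee_fin mulr_ge0.
apply: eq_eseriesr => t _; apply: eq_eseriesr => x _; rewrite addn1 /=.
rewrite muleC; congr (_ * _).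
have mfx : measurable_fun (jump x) (fun w => (f (landing x w))%:E).
  apply: (measurable_funS measurableT (@subsetT _ _)); apply/measurable_EFinP.
  exact: (measurableT_comp mf (mlanding x)).
under eq_integral do rewrite EFinM.
rewrite (ge0_integralZr _ (mjump x) mfx).
- congr (_ * _); rewrite integral_mkcond; apply: eq_integral => w _.
  rewrite patchE indicE -/(jump x).
  by case: (w \in jump x); rewrite ?mulr1 ?mulr0.
- by move=> w _; rewrite lee_fin.
- by rewrite lee_fin.
Qed.

(** Indicators as test functions give the values on products of a singleton and
    a measurable set, and a measurable set is the disjoint union of its
    sections at the countably many durations. *)
Lemma excursion_law_unique (k1 k2 : probability (nat * ptmeas R)%type R) :
  is_excursion_law P0 VP P k1 -> is_excursion_law P0 VP P k2 ->
  forall B, measurable B -> k1 B = k2 B.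
Proof.
move=> h1 h2.
have bmn (T : measurableType _) (A : set T) : measurable A ->
    bounded_measurable_nonneg (\1_A : T -> R).
  move=> mA; split; first exact: measurable_indic.
    by move=> x; rewrite indicE ler0n.
  by exists 1%R => x; rewrite indicE; case: (x \in A).
have rectE (k : probability (nat * ptmeas R)%type R) t C : measurable C ->
    'E_k[fun z => (\1_C z.2 * \1_[set t] z.1)%R] = k ([set t] `*` C).
  move=> mC; rewrite unlock -[X in k X]setIT -integral_indic//.
    by apply: eq_integral => -[u nu] _; rewrite !indicE /= in_setX mulrC -mulnb natrM.
  exact: measurableX.
have rect12 t C : measurable C -> k1 ([set t] `*` C) = k2 ([set t] `*` C).
  by move=> mC; rewrite -!rectE// h1 ?h2//; exact: bmn.
move=> B mB.
have BE : B = \bigcup_(t in setT) ([set t] `*` [set nu | B (t, nu)]).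
  apply/seteqP; split=> [[t nu] Btnu|[t nu] [_ _ [/= <-]]//]; by exists t.
have mS t : measurable ([set t] `*` [set nu | B (t, nu)]).
  by apply: measurableX => //; exact: measurable_section.
have tS : trivIset setT (fun t => [set t] `*` [set nu | B (t, nu)]).
  by move=> t t' _ _ [[u nu] [[/= <- _] [/= <- _]]].
rewrite BE; have [_ ->] := measure_esum k1 (fun t _ => mS t) tS.
have [_ ->] := measure_esum k2 (fun t _ => mS t) tS.
by apply: eq_esum => t _; apply: rect12; exact: measurable_section.
Qed.

Lemma excursion_lawE (kappa : probability (nat * ptmeas R)%type R) B :
  is_excursion_law P0 VP P kappa -> measurable B ->
  first_excursion_law lam B = m%:E * kappa B.
Proof.
move=> h mB; have [k [hk <-//]] := exists_excursion_law.
by rewrite (excursion_law_unique hk h).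
Qed.

End excursion_measure.

(** * Sequences killed at a random index *)

Section killed_sequences.
Context d (E : measurableType d).
Implicit Types y : power nat (option E).

Definition prefix_in n (B : nat -> set E) : set (power nat (option E)) :=
  [set y | forall i, (i < n)%N -> exists2 z, B i z & y i = Some z].

Definition absorbed y : Prop := forall i j, (i <= j)%N -> y i = None -> y j = None.

Lemma measurable_option d1 (T : measurableType d1) (X : T -> option E) :
  (forall B, measurable B -> measurable [set w | exists2 z, B z & X w = Some z]) ->
  measurable_fun setT X.
Proof.
move=> h _ C mC; rewrite setTI.
have -> : X @^-1` C = [set w | exists2 z, C (Some z) & X w = Some z] `|`
    (~` [set w | exists2 z, setT z & X w = Some z] `&` [set w | C None]).
  apply/seteqP; split=> w /=.
    case Xw : (X w) => [z|] Cw; first by left; exists z.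
    by right; split=> // -[].
  case=> [[z Cz ->]//|[]]; case Xw : (X w) => [z|] h' // _.
  by case: h'; exists z.
apply: measurableU; first exact: h.
apply: measurableI; first by apply: measurableC; exact: h.
have [CN|CN] := pselect (C None).
  by rewrite (_ : [set w | C None] = setT)//; apply/seteqP; split.
by rewrite (_ : [set w | C None] = set0)//; apply/seteqP; split.
Qed.

(** The sets [prefix_in n B] do not generate all measurable sets, but on
    absorbed sequences the value at [i] is defined only if all earlier ones are,
    so each cylinder coincides there with such a set or with the complement of
    one. The pi-system [G] consists of the sets that agree with some
    [prefix_in n B] on absorbed sequences. *)
Lemma eq_in_law_absorbed (R : realType)
    d1 (W1 : measurableType d1) (P1 : probability W1 R)
    d2 (W2 : measurableType d2) (P2 : probability W2 R)
    (X1 : W1 -> power nat (option E)) (X2 : W2 -> power nat (option E)) :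
  measurable_fun setT X1 -> measurable_fun setT X2 ->
  (forall w, absorbed (X1 w)) -> (forall w, absorbed (X2 w)) ->
  (forall n B, (forall i, measurable (B i)) ->
     P1 (X1 @^-1` prefix_in n B) = P2 (X2 @^-1` prefix_in n B)) ->
  eq_in_law P1 P2 X1 X2.
Proof.
move=> mX1 mX2 aX1 aX2 h.
have mp1 A : measurable A -> measurable (X1 @^-1` A).
  by move=> mA; rewrite -[X in measurable X]setTI; exact: mX1.
have mp2 A : measurable A -> measurable (X2 @^-1` A).
  by move=> mA; rewrite -[X in measurable X]setTI; exact: mX2.
pose G : set (set (power nat (option E))) := [set A | measurable A /\
  exists n B, (forall i, measurable (B i)) /\
    forall y, absorbed y -> A y <-> prefix_in n B y].
have GE : @measurable _ (power nat (option E)) = <<s G >>.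
  apply/seteqP; split; last first.
    by apply: smallest_sub; [exact: sigma_algebra_measurable|move=> A []].
  apply: smallest_sub; first exact: smallest_sigma_algebra.
  have some_in i (C : set (option E)) : measurable C -> ~ C None ->
      <<s G >> [set y | C (y i)].
    move=> mC CN; apply: sub_sigma_algebra; split.
      rewrite -[X in measurable X]setTI.
      exact: (@measurable_coordinate nat _ (option E) i measurableT _ mC).
    exists i.+1, (fun j => if j == i then Some @^-1` C else setT); split.
      by move=> j; case: ifP.
    move=> y ay; split=> [Cy j|/(_ i (leqnn _))]; last first.
      by rewrite eqxx => -[z Cz /= ->].
    rewrite ltnS => ji; case yj : (y j) => [z|].
      exists z => //; case: eqP => // jiE.
      by rewrite /preimage /= -yj jiE.
    by exfalso; apply: CN; rewrite -(ay _ _ ji yj).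
  move=> _ [i _ [C mC <-]]; rewrite setTI.
  have [CN|CN] := pselect (C None); last exact: some_in.
  rewrite -[X in <<s G >> X]setCK.
  have [_ sC _] := smallest_sigma_algebra setT G.
  rewrite -setTD; apply: sC; apply: (some_in i (~` C)); first exact: measurableC.
  by move=> /(_ CN).
split=> // A; rewrite GE; move: A; apply: (dynkin_induction GE).
- move=> A A' [mA [n [B [mB AE]]]] [mA' [n' [B' [mB' AE']]]]; split.
    exact: measurableI.
  exists (maxn n n'), (fun i => (if (i < n)%N then B i else setT) `&`
    (if (i < n')%N then B' i else setT)); split.
    by move=> i; apply: measurableI; case: ifP.
  move=> y ay; split.
    move=> [/(AE _ ay) h1 /(AE' _ ay) h2] i im.
    have [lin|nin] := ltnP i n; have [lin'|nin'] := ltnP i n'.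
    + have [z Bz yz] := h1 _ lin; have [z' Bz' yz'] := h2 _ lin'.
      by exists z => //; split=> //; move: yz'; rewrite yz => -[->].
    + by have [z Bz yz] := h1 _ lin; exists z.
    + by have [z Bz yz] := h2 _ lin'; exists z.
    + by move: im; rewrite leq_max ltnNge nin ltnNge nin'.
  move=> hy; split; [apply/AE|apply/AE'] => // i im.
    have [|z [Bz _] yz] := hy i; first by rewrite leq_max im.
    by exists z => //; rewrite im in Bz.
  have [|z [_ Bz] yz] := hy i; first by rewrite leq_max im orbT.
  by exists z => //; rewrite im in Bz.
- by rewrite !preimage_setT !probability_setT.
- move=> A [mA [n [B [mB AE]]]].
  have -> : X1 @^-1` A = X1 @^-1` prefix_in n B.
    by apply/seteqP; split=> w /= /AE; apply.
  have -> : X2 @^-1` A = X2 @^-1` prefix_in n B.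
    by apply/seteqP; split=> w /= /AE; apply.
  exact: h.
- move=> A mA IH; change (P1 (~` (X1 @^-1` A)) = P2 (~` (X2 @^-1` A))).
  by rewrite (probability_setC P1 (mp1 _ mA)) (probability_setC P2 (mp2 _ mA)) IH.
- move=> F mF tF IH; rewrite !preimage_bigcup !measure_bigcup//.
  + by apply: eq_eseriesr => i _; exact: IH.
  + by move=> i _; exact: mp2.
  + by move=> i j _ _ [w [Fi Fj]]; apply: tF => //; exists (X2 w).
  + by move=> i _; exact: mp1.
  + by move=> i j _ _ [w [Fi Fj]]; apply: tF => //; exists (X1 w).
Qed.

End killed_sequences.

Section geometric_tail.
Context {R : realType} d (W : measurableType d) (P : probability W R).
Variables (G : W -> option nat) (m : R).
Hypotheses (mG : measurable_fun setT G) (m01 : 0 <= m <= 1).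
Hypothesis G_law : geometric_law P G (1 - m).

Lemma measurable_geometric (C : set (option nat)) : measurable (G @^-1` C).
Proof. by rewrite -[X in measurable X]setTI; exact: mG. Qed.

(** The value [n = 0] says that [G] does not vanish, which the law of [G] only
    implies through its total mass. *)
Lemma geometric_tail n : P [set w | ltn_inf n (G w)] = (m ^+ n)%:E.
Proof.
have [/andP[m0 m1] [G1 G2]] := (m01, G_law).
pose a k : R := fine (P [set w | ltn_inf k (G w)]).
have mGe (C : set (option nat)) : measurable [set w | C (G w)].
  exact: measurable_geometric.
have aE k : (a k)%:E = P [set w | ltn_inf k (G w)].
  by rewrite fineK// fin_num_measure//; exact: (mGe (fun g => ltn_inf k g)).
have step k : a k = a k.+1 + (1 - m) * m ^+ k.
  apply: EFin_inj; rewrite EFinD !aE.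
  have := G1 k.+1 isT; rewrite [in X in _ = X -> _]opprB addrCA subrr addr0 => <-.
  rewrite -measureU.
  - congr (P _); apply/seteqP; split=> w /=.
      case Gw : (G w) => [l|] /=; last by left.
      by rewrite leq_eqVlt => /orP[/eqP <-|?]; [right|left].
    case=> [|-> /=]; last exact: ltnSn.
    by case: (G w) => //= l; exact: ltnW.
  - exact: (mGe (fun g => ltn_inf k.+1 g)).
  - exact: (mGe [set Some k.+1]).
  - by apply/seteqP; split=> // w [/= + Gw]; rewrite Gw /= ltnn.
(* The defect [a k - m ^+ k] does not depend on [k]; it is at most 0 at [k = 0],
   and at least [- m ^+ k] for every [k]. *)
have const k : a k - m ^+ k = a 0%N - 1.
  elim: k => [|k IH]; first by rewrite expr0.
  by rewrite -IH (step k) exprS; lra.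
have a0 k : 0 <= a k by rewrite fine_ge0.
have a01 : a 0%N <= 1.
  by rewrite -lee_fin aE probability_le1//; exact: (mGe (fun g => ltn_inf 0 g)).
rewrite -aE; congr EFin; suff : 1 <= a 0%N by have := const n; lra.
have [mE|mn1] := eqVneq m 1.
  rewrite -lee_fin aE -(G2 _); last by rewrite mE subrr.
  apply: le_measure; rewrite ?inE; [exact: (mGe [set None])|exact: (mGe (fun g => ltn_inf 0 g))|].
  by move=> w /= ->.
have cm : (fun k => 1 - m ^+ k) @ \oo --> (1 : R).
  rewrite -[X in _ --> X]subr0; apply: cvgB; first exact: cvg_cst.
  by apply: cvg_expr; rewrite ger0_norm// lt_neqAle mn1.
rewrite -(cvg_lim _ cm)//; apply: limr_le; first by apply/cvg_ex; exists 1.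
by apply: nearW => k; have := const k; have := a0 k; lra.
Qed.

End geometric_tail.

(** * Comparison of the two sequences *)

Lemma killed_absorbed d (E : measurableType d) (G : option nat) (X : nat -> E) :
  absorbed (killed G X).
Proof.
move=> i j ij; rewrite /killed; case: ifP => // Gi _; case: ifPn => // Gj.
by move: Gi Gj; case: G => //= m; lia.
Qed.

Lemma killed_prefix d (E : measurableType d) (G : option nat) (X : nat -> E)
    n (B : nat -> set E) :
  prefix_in n B (killed G X) <->
  forall i, (i < n)%N -> ltn_inf i.+1 G /\ B i (X i).
Proof.
split=> h i im.
  by have [z Bz] := h i im; rewrite /killed; case: ifP => // _ [->].
by have [Gi Bi] := h i im; exists (X i) => //; rewrite /killed Gi.
Qed.

Section walk_side.
Context {R : realType}.
Variables (P : probability (Omega R) R) (lam : probability (state R) R).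
Hypothesis P_indep : independent_family P (fun (n : int) (om : Omega R) => om n).
Hypothesis P_law : forall (n : int) A, measurable A ->
  P ((fun om : Omega R => om n) @^-1` A) = lam A.

Let walk_killed (om : Omega R) := killed (Gstop om) (excursions om).

Lemma preimage_walk_killed n B :
  walk_killed @^-1` prefix_in n B = excursions_in n B.
Proof.
apply/seteqP; split=> om; rewrite /preimage /= killed_prefix => h i im.
  by have [/ltn_Gstop] := h i im.
by have [Ti Bi] := h i im; split=> //; apply/ltn_Gstop.
Qed.

Lemma measurable_walk_killed : measurable_fun setT walk_killed.
Proof.
apply: (@measurable_power _ _ nat _ (option (nat * ptmeas R)%type)) => i.
apply: measurable_option => B mB.
(* Entry [i] is defined with value in [B] iff the first [i.+1] excursions are
   complete and the last of them is in [B]. *)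
rewrite (_ : [set w | _] =
    excursions_in i.+1 (fun j => if j == i then B else setT)).
  by apply: (P_excursions P_indep P_law i.+1 _).1 => j; case: ifP.
rewrite -preimage_walk_killed; apply/seteqP; split=> om /=; last first.
  by move=> /(_ i (leqnn _)); rewrite eqxx.
move=> [z Bz kz] j; rewrite ltnS => ji; have [->|jni] := eqVneq j i; first by exists z.
case kj : (walk_killed om j) => [z'|]; first by exists z'.
by have := killed_absorbed ji kj; rewrite -/(walk_killed om) kz.
Qed.

End walk_side.

Section renewal_side.
Context {R : realType} d' (W' : measurableType d') (P' : probability W' R).
Context d (E : measurableType d) (kappa : probability E R) (m : R).
Variables (TQ : nat -> {RV P' >-> E}) (Gstar : {RV P' >-> option nat}).
Hypothesis m01 : 0 <= m <= 1.
Hypothesis TQ_indep : independent_family P' TQ.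
Hypothesis TQ_law : forall (i : nat) B, measurable B ->
  distribution P' (TQ i) B = kappa B.
Hypothesis G_law : geometric_law P' Gstar (1 - m).
Hypothesis G_indep : independent_pair P' Gstar
  (fun w => (fun i => TQ i w) : power nat E).

Let renewal_killed w := killed (Gstar w) (fun i => TQ i w).

Lemma measurable_renewal_killed : measurable_fun setT renewal_killed.
Proof.
apply: (@measurable_power _ _ nat _ (option E)) => i.
apply: measurable_option => B mB.
rewrite (_ : [set w | _] = Gstar @^-1` [set g | ltn_inf i.+1 g] `&` TQ i @^-1` B).
  apply: measurableI; last by apply: measurable_funPTI.
  exact: (measurable_geometric (measurable_funPT Gstar)).
apply/seteqP; split=> w /=; rewrite /renewal_killed /killed.
  by case=> z Bz; case: ifP => // Gi [->].
by move=> [-> Bi]; exists (TQ i w).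
Qed.

Lemma P_renewal_killed n (B : nat -> set E) : (forall i, measurable (B i)) ->
  P' (renewal_killed @^-1` prefix_in n B) = (\prod_(i < n) (m%:E * kappa (B i)))%E.
Proof.
move=> mB; case: n => [|n].
  rewrite big_ord0 (_ : _ @^-1` _ = setT) ?probability_setT//.
  by apply/seteqP; split=> w // _ i.
have -> : renewal_killed @^-1` prefix_in n.+1 B =
    Gstar @^-1` [set g | ltn_inf n.+1 g] `&`
    (fun w => (fun i => TQ i w) : power nat E) @^-1`
       [set y | forall i, (i < n.+1)%N -> B i (y i)].
  apply/seteqP; split=> w; rewrite /preimage /= killed_prefix.
    by move=> h; split=> [|i /h[]//]; have [] := h n (leqnn _).
  move=> [Gn h] i im; split; last exact: h.
  by move: Gn; case: (Gstar w) => //= g; apply: leq_ltn_trans.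
have EbigI : [set y : power nat E | forall i, (i < n.+1)%N -> B i (y i)] =
    \bigcap_(i in `I_n.+1) ((fun y : power nat E => y i) @^-1` B i).
  by apply/seteqP; split.
rewrite G_indep//; last first.
  rewrite EbigI; apply: bigcap_measurable => [|i _]; first by exists 0%N.
  rewrite -[X in measurable X]setTI.
  exact: (@measurable_coordinate nat _ E i measurableT _ (mB i)).
rewrite (geometric_tail (measurable_funPT Gstar) m01 G_law n.+1).
rewrite big_split/= prodEFin prodr_const card_ord; congr (_ * _)%E.
have := TQ_indep (iota_uniq 0 n.+1) mB.
rewrite -{1 2}[n.+1]subn0 -/(index_iota 0 n.+1) !big_mkord => TQn.
transitivity (P' (\big[setI/setT]_(i < n.+1) (TQ i @^-1` B i))).
  congr (P' _); rewrite EbigI preimage_bigcap.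
  exact: (bigcap_mkord n.+1 (fun i => TQ i @^-1` B i)).
by rewrite TQn; apply: eq_bigr => i _; exact: TQ_law.
Qed.

End renewal_side.

Theorem lemma3p13 (R : realType)
    (d0 : measure_display) (W0 : measurableType d0) (P0 : probability W0 R)
    (VP : {RV P0 >-> state R})
    (mean_pos : (0 < mean_mass P0 VP)%E) (mean_le1 : (mean_mass P0 VP <= 1)%E)
    (P : probability (Omega R) R)
    (P_indep : independent_family P (fun (n : int) (om : Omega R) => om n))
    (P_law : forall n : int, eq_in_law P P0 (fun om : Omega R => om n) VP) :
  (exists kappa : probability (nat * ptmeas R)%type R,
     is_excursion_law P0 VP P kappa) /\
  (forall kappa : probability (nat * ptmeas R)%type R,
     is_excursion_law P0 VP P kappa ->
   forall (d' : measure_display) (W' : measurableType d')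
     (P' : probability W' R)
     (TQ : nat -> {RV P' >-> (nat * ptmeas R)%type})
     (Gstar : {RV P' >-> option nat}),
     independent_family P' TQ ->
     (forall (i : nat) (B : set (nat * ptmeas R)), measurable B ->
        distribution P' (TQ i) B = kappa B) ->
     geometric_law P' Gstar (1 - fine (mean_mass P0 VP)) ->
     independent_pair P' Gstar
       (fun w => (fun i => TQ i w) : power nat (nat * ptmeas R)) ->
     eq_in_law P P'
       (fun om : Omega R => killed (Gstop om) (excursions om))
       (fun w => killed (Gstar w) (fun i => TQ i w))).
Proof.
have law n A : measurable A ->
    P ((fun om : Omega R => om n) @^-1` A) = distribution P0 VP A.
  by have [_ _] := P_law n; apply.
split.
  have [kappa [hk _]] := exists_excursion_law P_indep law mean_pos mean_le1.
  by exists kappa.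
move=> kappa hk d' W' P' TQ Gstar TQ_indep TQ_law G_law G_indep.
have m01 : 0 <= fine (mean_mass P0 VP) <= 1.
  rewrite fine_ge0 ?(ltW mean_pos)//= -lee_fin.
  by rewrite (mean_mass_fineK mean_pos mean_le1).
apply: eq_in_law_absorbed.
- exact: (measurable_walk_killed P_indep law).
- exact: measurable_renewal_killed.
- by move=> om; exact: killed_absorbed.
- by move=> w; exact: killed_absorbed.
- move=> n B mB; rewrite (P_renewal_killed m01 TQ_indep TQ_law G_law G_indep n mB).
  rewrite (preimage_walk_killed n B) (P_excursions P_indep law n mB).2.
  apply: eq_bigr => i _.
  exact: (excursion_lawE P_indep law mean_pos mean_le1 hk (mB i)).
Qed.
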